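(* There is an absolute constant $c>0$ such that the following holds. Let $\delta\in(0,1]$ and let $N$ be a positive integer with $N\ge \exp\exp\exp(\delta^{-c})$. Let $A\subseteq\{1,\dots,N\}^2$ with $|A|\ge\delta N^2$. Then there exist integers $k,m$ and $d>0$ such that $(k,m),(k+d,m),(k,m+d)$ all belong to $A$. *)

(* Shkredov's density increment argument, run along arithmetic progressions.
   A corner-free [A] in [X * Y], inside a square cell of side [n], whose sides
   [X] and [Y] have balanced functions with small Gowers U2 norm, must have a
   balanced function with a large box norm on some subsquare (two applications
   of Cauchy-Schwarz); hence [A] is denser, by a power of its density, on some
   product set [X' * Y'].  The new sides need not be uniform, but a large U2
   norm gives a large Fourier coefficient, and then, by Dirichlet's theorem, a
   common difference [q] along whose progressions the squared density of the
   side increases on average.  Replacing cells by windows of difference [q]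
   must therefore reach a uniform cell on which [A] has kept its density, after
   a number of steps polynomial in the densities of the sides.  These densities
   may become exponentially small in a power of [1 / delta] and each step takes
   a fourth root of the side, which accounts for the triple exponential. *)

From mathcomp Require Import all_boot all_order all_algebra.
From mathcomp Require Import finmap.
From mathcomp Require Import all_classical all_reals all_analysis.
From mathcomp Require Import cyclic separable cyclotomic complex ring lra zify.

Set Implicit Arguments.
Unset Strict Implicit.
Unset Printing Implicit Defensive.
Import Order.TTheory GRing.Theory Num.Theory.
Local Open Scope ring_scope.

(** * Cauchy-Schwarz and the Gowers norms *)

(** No good window is ever selected; everything is averaged over all windows. Windows that hang over
    the edge of the cell are kept, so each point lies in exactly [L] of them and counts sum without
    boundary terms; the overhang costs a factor close to 1, measured by [tau]. Both coordinates are
    cut with the same difference, so that corners go to corners. The obstacle is the order of the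
    constants. Uniformity is useful only if [eta] is small against a power of the side densities,
    and each increment may shrink the sides by a factor [th]. Hence the number [K] of increments is
    fixed first, then the lower bound [e] of order [th ^ K] for the side densities, then [eta], the
    number [T] of refinements per increment, the overhang [tau] and the length [h]. Since [K] is
    polynomial in the inverse density and sits in an exponent, [T] is already exponential; taking
    [T * K] successive fourth roots adds two exponentials. Inside the argument a corner may have
    either sign of [d]; positive [d] is arranged at the end by passing to a centrally symmetric
    subset, at the cost of squaring the density. *)

Section CauchySchwarz.
Variables (R : realFieldType) (I : finType).

Lemma cauchy_schwarz (w a b : I -> R) : (forall i, 0 <= w i) ->
  (\sum_i w i * (a i * b i)) ^+ 2 <=
  (\sum_i w i * a i ^+ 2) * (\sum_i w i * b i ^+ 2).
Proof.
move=> w0.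
have : 0 <= \sum_i \sum_j (w i * w j) * (a i * b j - a j * b i) ^+ 2.
  by apply: sumr_ge0 => i _; apply: sumr_ge0 => j _; rewrite mulr_ge0 ?sqr_ge0 ?mulr_ge0.
have -> : \sum_i \sum_j (w i * w j) * (a i * b j - a j * b i) ^+ 2 =
  (\sum_i w i * a i ^+ 2) * (\sum_i w i * b i ^+ 2)
  + (\sum_i w i * b i ^+ 2) * (\sum_i w i * a i ^+ 2)
  - 2 * ((\sum_i w i * (a i * b i)) * (\sum_i w i * (a i * b i))).
  rewrite !big_distrlr /= mulr_sumr -big_split -sumrB /=; apply: eq_bigr => i _.
  rewrite mulr_sumr -big_split -sumrB /=; apply: eq_bigr => j _; ring.
by rewrite -expr2; lra.
Qed.

Lemma sqr_sum_weight (w a : I -> R) : (forall i, 0 <= w i) ->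
  (\sum_i w i * a i) ^+ 2 <= (\sum_i w i) * (\sum_i w i * a i ^+ 2).
Proof.
move=> w0; have := @cauchy_schwarz w (fun=> 1) a w0.
by under eq_bigr do rewrite mul1r; under [in X in _ <= X * _]eq_bigr do rewrite expr1n mulr1.
Qed.

Lemma cauchy_schwarz1 (a b : I -> R) :
  (\sum_i a i * b i) ^+ 2 <= (\sum_i a i ^+ 2) * (\sum_i b i ^+ 2).
Proof.
have := @cauchy_schwarz (fun=> 1) a b (fun=> ler01).
have E (c : I -> R) : \sum_i 1 * c i = \sum_i c i by apply: eq_bigr => i _; rewrite mul1r.
by rewrite !E.
Qed.

Lemma sqr_sum (a : I -> R) : (\sum_i a i) ^+ 2 <= #|I|%:R * (\sum_i a i ^+ 2).
Proof.
have := @sqr_sum_weight (fun=> 1) a (fun=> ler01).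
rewrite sumr_const; under eq_bigr do rewrite mul1r.
by under [in X in _ <= _ * X]eq_bigr do rewrite mul1r.
Qed.

End CauchySchwarz.

Lemma sqr_sum_ord (R : realFieldType) (n : nat) (a : nat -> R) :
  (\sum_(i < n) a i) ^+ 2 <= n%:R * (\sum_(i < n) a i ^+ 2).
Proof. by have := sqr_sum (fun i : 'I_n => a i); rewrite card_ord. Qed.

Section BoxNorm.
Variables (R : realFieldType) (G : finZmodType).

(** The unnormalised fourth power of the Gowers U2 norm, written as the energy of the
    autocorrelation: the form met both by Cauchy-Schwarz and by Parseval. *)
Definition u2 (u : G -> R) : R := \sum_t (\sum_x u x * u (x + t)) ^+ 2.

Lemma sum_shift (F : G -> R) (c : G) : \sum_x F (x + c) = \sum_x F x.
Proof. by rewrite [RHS](reindex_inj (addIr c)). Qed.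

Lemma sum_shiftN (F : G -> R) (c : G) : \sum_x F (c - x) = \sum_x F x.
Proof.
rewrite [RHS](reindex_inj (can_inj (subKr c))) /=.
by [].
Qed.

(** Expanding the square, a pair [y], [y'] contributes the autocorrelation of [u] at [y' - y]; the
    pairs are then grouped by their difference. *)
Lemma sum_sqr_conv (u h : G -> R) :
  \sum_z (\sum_y u (z - y) * h y) ^+ 2 =
  \sum_t (\sum_x u x * u (x + t)) * (\sum_y h y * h (y + t)).
Proof.
transitivity (\sum_y \sum_y' h y * h y' * \sum_z u (z - y) * u (z - y')).
  under eq_bigr do rewrite expr2 big_distrlr /=.
  rewrite exchange_big /=; apply: eq_bigr => y _.
  rewrite exchange_big /=; apply: eq_bigr => y' _.
  by rewrite mulr_sumr; apply: eq_bigr => z _; ring.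
transitivity (\sum_y \sum_t h y * h (y + t) * \sum_x u x * u (x + t)).
  apply: eq_bigr => y _.
  rewrite (reindex_inj (addrI y)) /=; apply: eq_bigr => t _; congr (_ * _).
  rewrite -[LHS](sum_shift _ (y + t)); apply: eq_bigr => x _.
  by rewrite addrK mulrC; congr (_ * u _); rewrite [y + t]addrC addrA addrK.
rewrite exchange_big /=; apply: eq_bigr => t _.
by rewrite -mulr_suml mulrC.
Qed.

(** Cauchy-Schwarz in the difference [t]: the autocorrelation [H] of [h] has supremum at most [n]
    and mass at most [n ^ 2], hence energy at most [n ^ 3]. *)
Lemma sum_sqr_conv_le (u h : G -> R) (n eta : R) :
  0 <= n -> 0 <= eta -> (forall x, `|h x| <= 1) -> \sum_x `|h x| <= n ->
  u2 u <= eta ^+ 2 * n ^+ 3 ->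
  \sum_z (\sum_y u (z - y) * h y) ^+ 2 <= eta * n ^+ 3.
Proof.
move=> n0 eta0 h1 hn hu; set H := fun t => \sum_y h y * h (y + t).
have Hn t : `|H t| <= n.
  apply: (le_trans (ler_norm_sum _ _ _)); apply: le_trans hn.
  by apply: ler_sum => y _; rewrite normrM ler_piMr.
have sH : \sum_t `|H t| <= n ^+ 2.
  apply: (@le_trans _ _ (\sum_t \sum_y `|h y| * `|h (y + t)|)).
    apply: ler_sum => t _; apply: (le_trans (ler_norm_sum _ _ _)).
    by apply: ler_sum => y _; rewrite normrM.
  rewrite exchange_big /=.
  under eq_bigr do rewrite -mulr_sumr.
  have E y : \sum_t `|h (y + t)| = \sum_t `|h t|.
    by rewrite -[RHS](sum_shift _ y); apply: eq_bigr => t _; rewrite addrC.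
  under eq_bigr do rewrite E.
  rewrite -mulr_suml expr2; apply: ler_pM => //; exact: sumr_ge0.
have sH2 : \sum_t H t ^+ 2 <= n ^+ 3.
  apply: (@le_trans _ _ (\sum_t n * `|H t|)).
    apply: ler_sum => t _; rewrite -real_normK ?num_real// expr2.
    exact: ler_wpM2r.
  by rewrite -mulr_sumr exprS ler_wpM2l.
have key : (\sum_z (\sum_y u (z - y) * h y) ^+ 2) ^+ 2 <= (eta * n ^+ 3) ^+ 2.
  rewrite sum_sqr_conv.
  have := cauchy_schwarz1 (fun t => \sum_x u x * u (x + t)) H.
  move=> /le_trans; apply.
  have -> : (eta * n ^+ 3) ^+ 2 = (eta ^+ 2 * n ^+ 3) * n ^+ 3 by ring.
  apply: ler_pM => //; apply: sumr_ge0 => t _; exact: sqr_ge0.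
move: key; rewrite ler_sqr// nnegrE; first exact: sumr_ge0 (fun _ _ => sqr_ge0 _).
by rewrite mulr_ge0 ?exprn_ge0.
Qed.

(* Writing [X = beta I + u] and using [(a + b)^2 <= 2 a^2 + 2 b^2]: only upper
   bounds for sums of squares are needed, so the loss of 2 is harmless. *)
Lemma sum_sqr_conv_replace (X I w h : G -> R) (beta n eta : R) :
  0 <= n -> 0 <= eta -> (forall z, 0 <= w z <= 1) ->
  (forall x, `|h x| <= 1) -> \sum_x `|h x| <= n ->
  u2 (fun x => X x - beta * I x) <= eta ^+ 2 * n ^+ 3 ->
  \sum_z w z * (\sum_y X (z - y) * h y) ^+ 2 <=
  2 * beta ^+ 2 * (\sum_z w z * (\sum_y I (z - y) * h y) ^+ 2)
  + 2 * eta * n ^+ 3.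
Proof.
move=> n0 eta0 w01 h1 hn hu.
have := sum_sqr_conv_le n0 eta0 h1 hn hu => H.
apply: (@le_trans _ _ (\sum_z (2 * beta ^+ 2 * (w z * (\sum_y I (z - y) * h y) ^+ 2)
   + 2 * (\sum_y (X (z - y) - beta * I (z - y)) * h y) ^+ 2))); last first.
  by rewrite big_split /= -!mulr_sumr lerD2l -mulrA ler_wpM2l.
apply: ler_sum => z _.
set a := \sum_y I (z - y) * h y; set e := \sum_y (_ - _) * _.
have -> : \sum_y X (z - y) * h y = beta * a + e.
  by rewrite mulr_sumr -big_split /=; apply: eq_bigr => y _; ring.
have /andP[w0 w1] := w01 z.
have ? : 0 <= (beta * a - e) ^+ 2 by exact: sqr_ge0.
have ? : 0 <= e ^+ 2 by exact: sqr_ge0.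
have h2 : w z * (beta * a - e) ^+ 2 >= 0 by exact: mulr_ge0.
have h3 : (1 - w z) * e ^+ 2 >= 0 by rewrite mulr_ge0 // subr_ge0.
nra.
Qed.

(** Both sides are one sum over rectangles, so either variable may be taken as the inner one. *)
Lemma box_swap (p q : G -> R) (f : G -> G -> R) :
  \sum_y \sum_y' p y * p y' * (\sum_x q x * (f x y * f x y')) ^+ 2 =
  \sum_x \sum_x' q x * q x' * (\sum_y p y * (f x y * f x' y)) ^+ 2.
Proof.
transitivity (\sum_y \sum_y' \sum_x \sum_x' p y * p y' * (q x * q x') *
   (f x y * f x y' * f x' y * f x' y')).
  apply: eq_bigr => y _; apply: eq_bigr => y' _.
  rewrite expr2 big_distrlr /= mulr_sumr; apply: eq_bigr => x _.
  by rewrite mulr_sumr; apply: eq_bigr => x' _; ring.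
transitivity (\sum_x \sum_x' \sum_y \sum_y' p y * p y' * (q x * q x') *
   (f x y * f x y' * f x' y * f x' y')); last first.
  apply: eq_bigr => x _; apply: eq_bigr => x' _.
  rewrite expr2 big_distrlr /= mulr_sumr; apply: eq_bigr => y _.
  by rewrite mulr_sumr; apply: eq_bigr => y' _; ring.
under eq_bigr do rewrite exchange_big /=.
rewrite exchange_big /=; apply: eq_bigr => x _.
under eq_bigr do rewrite exchange_big /=.
rewrite exchange_big /=; apply: eq_bigr => x' _.
by [].
Qed.

(** The fourth power of the box norm of [f] restricted to the square of side [z - I]. The
    restriction is what is left of the weights [X (z - y)] and [Y (z - x)] once the sides are
    replaced by multiples of [I]. *)
Definition box (I : G -> R) (f : G -> G -> R) (z : G) : R :=
  \sum_x \sum_x' I (z - x) * I (z - x') *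
    (\sum_y I (z - y) * (f x y * f x' y)) ^+ 2.

(** For fixed [x], [x'] the product [f x y * f x' y], divided by [c = I x * I x'], is bounded by
    [I y], so [sum_sqr_conv_replace] applies. Dividing first leaves a factor [c] on the error, which
    over all pairs sums to only [n ^ 2]. *)
Lemma box_replace (X I : G -> R) (q : G -> G -> R) (f : G -> G -> R) (beta n eta : R) :
  0 <= eta -> (forall x, 0 <= I x <= 1) -> \sum_x I x = n ->
  (forall z x, 0 <= q z x <= 1) ->
  (forall x y, `|f x y| <= I x * I y) ->
  u2 (fun x => X x - beta * I x) <= eta ^+ 2 * n ^+ 3 ->
  \sum_z \sum_x \sum_x' q z x * q z x' * (\sum_y X (z - y) * (f x y * f x' y)) ^+ 2
  <= 2 * beta ^+ 2 *
   (\sum_z \sum_x \sum_x' q z x * q z x' * (\sum_y I (z - y) * (f x y * f x' y)) ^+ 2)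
   + 2 * eta * n ^+ 5.
Proof.
move=> eta0 I01 In q01 fI hu.
have I0 x : 0 <= I x by have /andP[] := I01 x.
have I1 x : I x <= 1 by have /andP[] := I01 x.
have n0 : 0 <= n by rewrite -In sumr_ge0.
have E (V : G -> R) : \sum_z \sum_x \sum_x' q z x * q z x' * (\sum_y V (z - y) * (f x y * f x' y)) ^+ 2
  = \sum_x \sum_x' \sum_z q z x * q z x' * (\sum_y V (z - y) * (f x y * f x' y)) ^+ 2.
  by rewrite exchange_big /=; apply: eq_bigr => x _; rewrite exchange_big.
rewrite !E mulr_sumr.
have -> : 2 * eta * n ^+ 5 = \sum_x \sum_x' (2 * eta * n ^+ 3) * (I x * I x').
  under eq_bigr do rewrite -mulr_sumr -mulr_sumr In.
  by rewrite -mulr_sumr -mulr_suml In; ring.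
rewrite -big_split /=; apply: ler_sum => x _.
rewrite mulr_sumr -big_split /=; apply: ler_sum => x' _.
have fb y : `|f x y * f x' y| <= I x * I x' * I y.
  rewrite normrM; apply: le_trans (ler_pM (normr_ge0 _) (normr_ge0 _) (fI _ _) (fI _ _)) _.
  have -> : I x * I y * (I x' * I y) = I x * I x' * I y * I y by ring.
  by rewrite ler_piMr // !mulr_ge0.
have [/eqP I0x|Ixx] := boolP (I x * I x' == 0).
  have f0 y : f x y * f x' y = 0.
    by apply/eqP; rewrite -normr_le0 (le_trans (fb y)) // I0x mul0r.
  have Z (V : G -> R) : \sum_z q z x * q z x' * (\sum_y V (z - y) * (f x y * f x' y)) ^+ 2 = 0.
    apply: big1 => z _; rewrite [\sum_(y : G) _]big1 ?expr0n ?mulr0 // => y _.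
    by rewrite f0 mulr0.
  by rewrite !Z I0x !mulr0 addr0.
have c0 : 0 < I x * I x' by rewrite lt_def Ixx mulr_ge0.
pose c := I x * I x'.
have c1 : c <= 1 by rewrite mulr_ile1.
have cu : c != 0 by [].
have hb y : `|c^-1 * (f x y * f x' y)| <= I y.
  by rewrite normrM gtr0_norm ?invr_gt0 // ler_pdivrMl // fb.
have hw z : 0 <= q z x * q z x' <= 1.
  have /andP[a b] := q01 z x; have /andP[a' b'] := q01 z x'.
  by rewrite mulr_ge0 // mulr_ile1.
have hs : \sum_y `|c^-1 * (f x y * f x' y)| <= n by rewrite -In; apply: ler_sum.
have := sum_sqr_conv_replace n0 eta0 hw (fun y => le_trans (hb y) (I1 y)) hs hu.
have Z (V : G -> R) : \sum_z q z x * q z x' * (\sum_y V (z - y) * (c^-1 * (f x y * f x' y))) ^+ 2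
  = c^-2 * \sum_z q z x * q z x' * (\sum_y V (z - y) * (f x y * f x' y)) ^+ 2.
  rewrite mulr_sumr; apply: eq_bigr => z _.
  have -> : \sum_y V (z - y) * (c^-1 * (f x y * f x' y)) = c^-1 * \sum_y V (z - y) * (f x y * f x' y).
    by rewrite mulr_sumr; apply: eq_bigr => y _; ring.
  by rewrite exprMn -exprVn; ring.
rewrite !Z -/c => H.
have {}H := ler_wpM2l (exprn_ge0 2 (ltW c0)) H.
rewrite mulVKf ?expf_neq0 // in H; apply: le_trans H _.
rewrite mulrDr.
have -> : c ^+ 2 * (2 * beta ^+ 2 * (c ^- 2 *
   (\sum_z q z x * q z x' * (\sum_y I (z - y) * (f x y * f x' y)) ^+ 2))) =
   2 * beta ^+ 2 * (\sum_z q z x * q z x' * (\sum_y I (z - y) * (f x y * f x' y)) ^+ 2).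
  by field.
rewrite lerD2l mulrC ler_wpM2l ?mulr_ge0 ?exprn_ge0 //.
by rewrite expr2 ler_piMl // ltW.
Qed.

(** [box_swap] brings the side to be replaced into the inner sum, first [X], then [Y]. The errors
    are [2 * eta * n ^ 5] and at most twice that. *)
Lemma box_replace2 (X Y I : G -> R) (f : G -> G -> R) (b1 b2 n eta : R) :
  0 <= eta -> (forall x, 0 <= I x <= 1) -> \sum_x I x = n ->
  (forall x, 0 <= Y x <= 1) -> 0 <= b1 <= 1 ->
  (forall x y, `|f x y| <= I x * I y) ->
  u2 (fun x => X x - b1 * I x) <= eta ^+ 2 * n ^+ 3 ->
  u2 (fun x => Y x - b2 * I x) <= eta ^+ 2 * n ^+ 3 ->
  \sum_z \sum_y \sum_y' X (z - y) * X (z - y') * (\sum_x Y (z - x) * (f x y * f x y')) ^+ 2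
  <= 4 * (b1 * b2) ^+ 2 * (\sum_z box I f z) + 6 * eta * n ^+ 5.
Proof.
move=> eta0 I01 In Y01 /andP[b10 b11] fI hX hY.
have n0 : 0 <= n by rewrite -In sumr_ge0 // => x _; have /andP[] := I01 x.
under eq_bigr do rewrite box_swap.
have := @box_replace X I (fun z x => Y (z - x)) f b1 n eta eta0 I01 In.
move=> /(_ (fun z x => Y01 _) fI hX) /le_trans; apply.
have := @box_replace Y I (fun z x => I (z - x)) (fun x y => f y x) b2 n eta eta0 I01 In.
move=> /(_ (fun z x => I01 _)) H.
have {H} := H (fun x y => _) hY.
have fI' x y : `|f y x| <= I x * I y by rewrite mulrC.
move=> /(_ fI') H.
under [in X in X <= _]eq_bigr do rewrite -box_swap.
move: H; under [in X in _ <= _ * X + _ -> _]eq_bigr do rewrite box_swap -/(box I f _).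
set P := \sum_z _; set Q := \sum_z _ => H.
have b12 : b1 ^+ 2 <= 1 by rewrite expr_le1.
have ? : 0 <= b1 ^+ 2 by rewrite sqr_ge0.
have en : 0 <= eta * n ^+ 5 by rewrite mulr_ge0 ?exprn_ge0.
have h1 : b1 ^+ 2 * P <= b1 ^+ 2 * (2 * b2 ^+ 2 * Q + 2 * eta * n ^+ 5) by rewrite ler_wpM2l.
have h2 : (1 - b1 ^+ 2) * (eta * n ^+ 5) >= 0 by rewrite mulr_ge0 // subr_ge0.
nra.
Qed.

End BoxNorm.

(** * Counting corners in a finite abelian group *)

Section VonNeumann.
Variables (R : realFieldType) (G : finZmodType).
Implicit Types (X Y : G -> R) (B C f : G -> G -> R).

(** With [z = x + y + d] the other vertices of a corner are [(z - y, y)] and [(x, z - x)]. The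
    weight [C] does not see [y], so Cauchy-Schwarz over [(x, z)] removes it: its mass is kept in one
    factor, and in the other it is enlarged to the full sides. *)
Lemma von_neumann_fst X Y B C f :
  (forall x z, 0 <= C x z <= X x * Y (z - x)) ->
  (\sum_z \sum_x C x z * \sum_y f x y * B y z) ^+ 2 <=
  (\sum_z \sum_x C x z) *
  (\sum_z \sum_x X x * Y (z - x) * (\sum_y f x y * B y z) ^+ 2).
Proof.
move=> hC; rewrite !pair_big /=.
have C0 x z : 0 <= C x z by have /andP[] := hC x z.
apply: le_trans (@sqr_sum_weight _ _ (fun p : G * G => C p.2 p.1)
  (fun p => \sum_y f p.2 y * B y p.1) (fun p => C0 _ _)) _.
apply: ler_wpM2l; first exact: sumr_ge0.
apply: ler_sum => p _; apply: ler_wpM2r; first exact: sqr_ge0.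
by have /andP[] := hC p.2 p.1.
Qed.

(** [B] does not see [x]: open the square, move the sum over [x] inside, enlarge [B] to the sides
    and apply Cauchy-Schwarz over [(z, y, y')]. *)
Lemma von_neumann_snd X Y B f :
  (forall x, 0 <= X x) -> (forall y, 0 <= Y y <= 1) ->
  (forall x y, X x * f x y = f x y) ->
  (forall y z, 0 <= B y z <= Y y * X (z - y)) ->
  (\sum_z \sum_x X x * Y (z - x) * (\sum_y f x y * B y z) ^+ 2) ^+ 2 <=
  (\sum_z (\sum_y X (z - y) * Y y) ^+ 2) *
  (\sum_z \sum_y \sum_y' X (z - y) * X (z - y') *
     (\sum_x Y (z - x) * (f x y * f x y')) ^+ 2).
Proof.
move=> X0 Y01 fX hB.
have Y0 y : 0 <= Y y by have /andP[] := Y01 y.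
have B0 y z : 0 <= B y z by have /andP[] := hB y z.
pose T z y y' := \sum_x Y (z - x) * (f x y * f x y').
pose w z y y' := (Y y * X (z - y)) * (Y y' * X (z - y')).
have w0 z y y' : 0 <= w z y y' by rewrite !mulr_ge0.
have E : \sum_z \sum_x X x * Y (z - x) * (\sum_y f x y * B y z) ^+ 2 =
    \sum_z \sum_y \sum_y' B y z * B y' z * T z y y'.
  apply: eq_bigr => z _.
  transitivity (\sum_x \sum_y \sum_y' B y z * B y' z * (Y (z - x) * (f x y * f x y'))).
    apply: eq_bigr => x _; rewrite expr2 big_distrlr /= mulr_sumr.
    apply: eq_bigr => y _; rewrite mulr_sumr; apply: eq_bigr => y' _.
    by rewrite -[in RHS](fX x y); ring.
  rewrite exchange_big /=; apply: eq_bigr => y _.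
  rewrite exchange_big /=; apply: eq_bigr => y' _.
  by rewrite mulr_sumr.
set U := (X in X ^+ 2 <= _).
have U0 : 0 <= U.
  apply: sumr_ge0 => z _; apply: sumr_ge0 => x _.
  by rewrite mulr_ge0 ?sqr_ge0 // mulr_ge0.
have UT : U <= \sum_z \sum_y \sum_y' w z y y' * `|T z y y'|.
  rewrite /U E; apply: ler_sum => z _; apply: ler_sum => y _; apply: ler_sum => y' _.
  apply: (@le_trans _ _ (B y z * B y' z * `|T z y y'|)).
    by rewrite ler_wpM2l ?ler_norm // mulr_ge0.
  apply: ler_wpM2r => //; apply: ler_pM => //.
    by have /andP[] := hB y z.
  by have /andP[] := hB y' z.
apply: (@le_trans _ _ ((\sum_z \sum_y \sum_y' w z y y' * `|T z y y'|) ^+ 2)).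
  by rewrite ler_sqr // nnegrE // (le_trans U0).
have -> : \sum_z \sum_y \sum_y' w z y y' * `|T z y y'| =
    \sum_(p : G * (G * G)) w p.1 p.2.1 p.2.2 * `|T p.1 p.2.1 p.2.2|.
  by under eq_bigr do rewrite pair_big; rewrite pair_big.
apply: le_trans (sqr_sum_weight _ _) _ => //.
apply: ler_pM.
- exact: sumr_ge0.
- by apply: sumr_ge0 => p _; rewrite mulr_ge0 ?sqr_ge0.
- have -> : \sum_(p : G * (G * G)) w p.1 p.2.1 p.2.2 = \sum_z \sum_y \sum_y' w z y y'.
    by under [RHS]eq_bigr do rewrite pair_big; rewrite [RHS]pair_big.
  apply: ler_sum => z _; rewrite expr2 big_distrlr /=.
  by apply: ler_sum => y _; apply: ler_sum => y' _; rewrite /w ![Y _ * _]mulrC.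
have -> : \sum_(p : G * (G * G)) w p.1 p.2.1 p.2.2 * `|T p.1 p.2.1 p.2.2| ^+ 2
  = \sum_z \sum_y \sum_y' w z y y' * `|T z y y'| ^+ 2.
  by under [RHS]eq_bigr do rewrite pair_big; rewrite [RHS]pair_big.
apply: ler_sum => z _; apply: ler_sum => y _; apply: ler_sum => y' _.
rewrite real_normK ?num_real // ler_wpM2r ?sqr_ge0 // /w.
have -> : Y y * X (z - y) * (Y y' * X (z - y')) =
   (Y y * Y y') * (X (z - y) * X (z - y')) by ring.
rewrite ler_piMl ?mulr_ge0 // mulr_ile1 //.
  by have /andP[] := Y01 y.
by have /andP[] := Y01 y'.
Qed.

End VonNeumann.

Section Counting.
Variables (R : realFieldType) (G : finZmodType).
Variables (I X Y : pred G) (A : rel G).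
Hypotheses (XI : forall x, X x -> I x) (YI : forall y, Y y -> I y).
Hypothesis (AXY : forall x y, A x y -> X x && Y y).
Hypothesis (cornerfree : forall x y d, A x y -> A (x + d) y -> A x (y + d) -> d = 0).

Let n : R := \sum_x (I x)%:R.
Let cX : R := \sum_x (X x)%:R.
Let cY : R := \sum_x (Y x)%:R.
Let cA : R := \sum_x \sum_y (A x y)%:R.

(** A nonzero term is a corner of difference [z - y - x], so only [z = x + y] survives, once for
    each point of [A]. *)
Lemma corner_count :
  \sum_x \sum_z (A x (z - x))%:R * \sum_y (A x y)%:R * (A (z - y) y)%:R = cA.
Proof.
apply: eq_bigr => x _.
transitivity (\sum_y \sum_z (A x (z - x))%:R * ((A x y)%:R * (A (z - y) y)%:R) : R).
  by under eq_bigr do rewrite mulr_sumr; rewrite exchange_big.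
apply: eq_bigr => y _; rewrite (bigD1 (x + y)) //= big1 ?addr0 => [|z zxy].
  have -> : x + y - x = y by rewrite addrC addKr.
  by rewrite addrK; case: (A x y); rewrite !(mulr0, mulr1).
case Axy: (A x y); rewrite ?(mul0r, mulr0) //.
case Az: (A (z - y) y); rewrite ?mulr0 //.
case Ax: (A x (z - x)); rewrite ?mul0r //.
have := @cornerfree x y (z - y - x) Axy.
have -> : x + (z - y - x) = z - y by rewrite addrC subrK.
have -> : y + (z - y - x) = z - x by rewrite addrA addrCA subrr addr0.
move=> /(_ Az Ax)/eqP; rewrite -addrA -opprD subr_eq0 addrC => /eqP zE.
by rewrite zE eqxx in zxy.
Qed.

Lemma diag_count : \sum_z \sum_x (A x (z - x))%:R = cA.
Proof.
rewrite exchange_big /=; apply: eq_bigr => x _.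
by rewrite -(sum_shift (fun z => _) x); apply: eq_bigr => z _; rewrite addrK.
Qed.

(** The sum on the right is the second moment of the number of points of [A] on the antidiagonals;
    Cauchy-Schwarz over the [#|G|] antidiagonals. *)
Lemma main_term_le : cA ^+ 2 <=
  #|G|%:R * \sum_z (\sum_x (A x (z - x))%:R) * (\sum_y (A (z - y) y)%:R).
Proof.
rewrite -{1}diag_count; apply: le_trans (sqr_sum _) _.
apply: ler_wpM2l => //; apply: ler_sum => z _; rewrite expr2.
rewrite [X in _ <= _ * X](_ : _ = \sum_x (A x (z - x))%:R) //.
rewrite -(sum_shiftN _ z).
by apply: eq_bigr => x _; rewrite opprB addrCA subrr addr0.
Qed.

Let bal (al : R) x y : R := (A x y)%:R - al * ((X x)%:R * (Y y)%:R).

(* If all the local box norms of the balanced function of a corner-free set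
   were small, the number of corners would be close to that of a random set,
   yet only the degenerate corners are available. *)
Lemma box_large (al eta kappa : R) :
  #|G|%:R <= 3 * n -> 0 < n -> 0 < cX -> 0 < cY ->
  al * (cX * cY) = cA -> 0 < al -> 0 < eta -> 0 < kappa <= 1 ->
  2 ^+ 18 * kappa <= al ^+ 10 ->
  eta <= kappa * (cX * cY / n ^+ 2) ^+ 4 ->
  6 <= al ^+ 2 * (cX * cY / n ^+ 2) * n ->
  u2 (fun x => (X x)%:R - cX / n * (I x)%:R) <= eta ^+ 2 * n ^+ 3 ->
  u2 (fun x => (Y x)%:R - cY / n * (I x)%:R) <= eta ^+ 2 * n ^+ 3 ->
  exists z, kappa * (cX * cY) ^+ 2 < box (fun x => (I x)%:R) (bal al) z.
Proof.
move=> hG n0 cX0 cY0 alE al0 eta0 /andP[k0 k1] kal etak ngt uX uY.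
have [/existsP//|/existsPn H] :=
  boolP [exists z, kappa * (cX * cY) ^+ 2 < box (fun x => (I x)%:R) (bal al) z].
exfalso.
set b := cX * cY / n ^+ 2 in etak ngt.
have I01 x : 0 <= ((I x)%:R : R) <= 1 by case: (I x); rewrite ?lexx ?ler01.
have X01 x : 0 <= ((X x)%:R : R) <= 1 by case: (X x); rewrite ?lexx ?ler01.
have Y01 x : 0 <= ((Y x)%:R : R) <= 1 by case: (Y x); rewrite ?lexx ?ler01.
have cXn : cX <= n.
  apply: ler_sum => x _; have := @XI x; case: (X x) => // /(_ isT) -> //.
have cYn : cY <= n.
  apply: ler_sum => x _; have := @YI x; case: (Y x) => // /(_ isT) -> //.
have n2 : 0 < n ^+ 2 by exact: exprn_gt0.
have bE : b * n ^+ 2 = cX * cY by rewrite /b divfK // lt0r_neq0.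
have b0 : 0 < b by rewrite divr_gt0 // mulr_gt0.
have b1 : b <= 1 by rewrite ler_pdivrMr // mul1r expr2 ler_pM // ltW.
have cA0 : 0 < cA by rewrite -alE mulr_gt0 // mulr_gt0.
have cAle : cA <= cX * cY.
  rewrite mulr_suml; apply: ler_sum => x _; rewrite mulr_sumr; apply: ler_sum => y _.
  case Axy: (A x y); last by rewrite mulr_ge0.
  by case/andP: (AXY Axy) => -> ->; rewrite mulr1.
have al1 : al <= 1 by rewrite -(ler_pM2r (mulr_gt0 cX0 cY0)) alE mul1r.
have fI x y : `|bal al x y| <= (I x)%:R * (I y)%:R.
  rewrite /bal; case Axy: (A x y).
    case/andP: (AXY Axy) => Xx Yy; rewrite Xx Yy (XI Xx) (YI Yy) !mulr1.
    by rewrite ger0_norm ?subr_ge0 //; lra.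
  rewrite sub0r normrN.
  case Xx: (X x); rewrite ?mul0r ?mulr0 ?normr0 ?mulr_ge0 // (XI Xx).
  case Yy: (Y y); rewrite ?mulr0 ?normr0 ?mulr_ge0 // (YI Yy).
  by rewrite !mulr1 gtr0_norm.
have fX x y : (X x)%:R * bal al x y = bal al x y.
  rewrite /bal; case Xx: (X x); first by rewrite mul1r.
  rewrite !mul0r mulr0 subr0; case Axy: (A x y) => //.
  by case/andP: (AXY Axy); rewrite Xx.
pose S : R := \sum_z \sum_y \sum_y' (X (z - y))%:R * (X (z - y'))%:R *
     (\sum_x (Y (z - x))%:R * (bal al x y * bal al x y')) ^+ 2.
pose F : R := \sum_z (\sum_y (X (z - y))%:R * (Y y)%:R) ^+ 2.
pose V : R := \sum_z \sum_x (X x)%:R * (Y (z - x))%:R *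
   (\sum_y bal al x y * (A (z - y) y)%:R) ^+ 2.
pose E : R := \sum_z \sum_x (A x (z - x))%:R * \sum_y bal al x y * (A (z - y) y)%:R.
pose D : R := \sum_z (\sum_x (A x (z - x))%:R) * (\sum_y (A (z - y) y)%:R).
have SB : S <= 18 * kappa * b ^+ 4 * n ^+ 5.
  have := @box_replace2 R G (fun x => (X x)%:R) (fun x => (Y x)%:R)
    (fun x => (I x)%:R) (bal al) (cX / n) (cY / n) n eta (ltW eta0) I01 erefl Y01.
  have h01 : 0 <= cX / n <= 1.
    by rewrite ler_pdivrMr // mul1r cXn andbT divr_ge0 // ltW.
  move=> /(_ h01 fI uX uY) /le_trans; apply.
  have -> : (cX / n * (cY / n)) = b by rewrite /b; field; exact: lt0r_neq0.
  have hb : \sum_z box (fun x => (I x)%:R) (bal al) z <= 3 * n * (kappa * (b * n ^+ 2) ^+ 2).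
    apply: (@le_trans _ _ (\sum_(z : G) kappa * (cX * cY) ^+ 2)).
      by apply: ler_sum => z _; rewrite leNgt H.
    by rewrite sumr_const bE -[X in X <= _]mulr_natl ler_wpM2r // mulr_ge0 ?sqr_ge0 ?ltW.
  have := ler_wpM2l (exprn_ge0 2 (ltW b0)) hb.
  have := ler_wpM2r (exprn_ge0 5 (ltW n0)) etak.
  set W : R := \sum_z _; move=> h1 h2.
  have -> : 18 * kappa * b ^+ 4 * n ^+ 5 =
    4 * (b ^+ 2 * (3 * n * (kappa * (b * n ^+ 2) ^+ 2))) + 6 * (kappa * b ^+ 4 * n ^+ 5) by ring.
  by lra.
have FB : F <= 8 * b ^+ 2 * n ^+ 3.
  have := @sum_sqr_conv_replace R G (fun x => (X x)%:R) (fun x => (I x)%:R) (fun=> 1)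
    (fun y => (Y y)%:R) (cX / n) n eta (ltW n0) (ltW eta0).
  have h1 (z : G) : 0 <= (1 : R) <= 1 by rewrite ler01 lexx.
  have h2 x : `|(Y x)%:R| <= 1 :> R by case: (Y x); rewrite ?normr1 ?normr0.
  have h3 : \sum_x `|(Y x)%:R| <= n.
    by apply: le_trans cYn; apply: ler_sum => x _; rewrite normr_nat.
  move=> /(_ h1 h2 h3 uX).
  have E1 (c : G -> R) : \sum_i 1 * c i = \sum_i c i by apply: eq_bigr => i _; rewrite mul1r.
  rewrite !E1 => /le_trans; apply.
  have h4 : \sum_z (\sum_y (I (z - y))%:R * (Y y)%:R) ^+ 2 <= 3 * n * cY ^+ 2.
    apply: (@le_trans _ _ (\sum_(z : G) cY ^+ 2)).
      apply: ler_sum => z _.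
      have h : \sum_y (I (z - y))%:R * (Y y)%:R <= cY.
        by apply: ler_sum => y _; rewrite ler_piMl //; have /andP[] := I01 (z - y).
      by rewrite lerXn2r // nnegrE ?(ltW cY0) // sumr_ge0 // => y _; rewrite mulr_ge0.
    by rewrite sumr_const -[X in X <= _]mulr_natl ler_wpM2r // sqr_ge0.
  have h5 : (cX / n) ^+ 2 * (3 * n * cY ^+ 2) = 3 * b ^+ 2 * n ^+ 3.
    by rewrite /b; field; exact: lt0r_neq0.
  have := ler_wpM2l (sqr_ge0 (cX / n)) h4; rewrite h5.
  have etab : eta <= b ^+ 2.
    apply: le_trans etak _; rewrite (@le_trans _ _ (1 * b ^+ 4)) //.
      by rewrite ler_wpM2r // exprn_ge0 // ltW.
    by rewrite mul1r ler_wiXn2l // ltW.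
  have := ler_wpM2r (exprn_ge0 3 (ltW n0)) etab.
  by clear h1 h2; set W : R := \sum_z _; lra.
have CX x z : 0 <= ((A x (z - x))%:R : R) <= (X x)%:R * (Y (z - x))%:R.
  case Axy: (A _ _); last by rewrite lexx mulr_ge0.
  by case/andP: (AXY Axy) => -> ->; rewrite mulr1 ler01 lexx.
have BY y z : 0 <= ((A (z - y) y)%:R : R) <= (Y y)%:R * (X (z - y))%:R.
  case Axy: (A _ _); last by rewrite lexx mulr_ge0.
  by case/andP: (AXY Axy) => -> ->; rewrite mulr1 ler01 lexx.
have E2 : E ^+ 2 <= cA * V.
  rewrite -diag_count.
  exact: (@von_neumann_fst R G (fun x => (X x)%:R) (fun y => (Y y)%:R)
    (fun y z => (A (z - y) y)%:R) (fun x z => (A x (z - x))%:R) (bal al) CX).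
have V2 : V ^+ 2 <= F * S.
  apply: (@von_neumann_snd R G (fun x => (X x)%:R) (fun y => (Y y)%:R)
    (fun y z => (A (z - y) y)%:R) (bal al) _ Y01 fX BY) => x.
  by have /andP[] := X01 x.
have V0 : 0 <= V.
  apply: sumr_ge0 => z _; apply: sumr_ge0 => x _.
  by rewrite mulr_ge0 ?sqr_ge0 // mulr_ge0.
have cAE : cA = al * D + E.
  rewrite -{1}corner_count exchange_big /= /D /E mulr_sumr -big_split /=.
  apply: eq_bigr => z _; rewrite mulr_suml mulr_sumr -big_split /=.
  apply: eq_bigr => x _; rewrite !mulr_sumr -big_split /=.
  apply: eq_bigr => y _; rewrite /bal.
  case Ax: (A x (z - x)); last by rewrite !(mul0r, mulr0) addr0.
  case Ay: (A (z - y) y); last by rewrite !(mul0r, mulr0) addr0.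
  case/andP: (AXY Ax) => -> _; case/andP: (AXY Ay) => _ ->.
  by rewrite !mulr1 !mul1r addrC subrK.
have D3 : cA ^+ 2 <= 3 * n * D.
  apply: le_trans main_term_le _; rewrite ler_wpM2r //.
  by apply: sumr_ge0 => z _; rewrite mulr_ge0 // sumr_ge0.
(* The degenerate corners, [cA] in number, are at most half of the lower bound
   [al * cA ^ 2 / (3 * n)] for the main term; so [E] must be very negative. *)
have Elow : al * cA ^+ 2 <= 6 * n * - E.
  have h1 : 6 * n <= al * cA.
    have -> : al * cA = (al ^+ 2 * b * n) * n by rewrite -alE -bE; ring.
    by rewrite ler_wpM2r // ltW.
  have h2 := ler_wpM2r (ltW cA0) h1.
  have h3 := ler_wpM2l (ltW al0) D3.
  have -> : - E = al * D - cA by rewrite cAE; ring.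
  by nra.
have E4 : E ^+ 4 <= cA ^+ 2 * (144 * kappa * b ^+ 6 * n ^+ 8).
  have -> : E ^+ 4 = (E ^+ 2) ^+ 2 by rewrite -exprM.
  apply: (@le_trans _ _ ((cA * V) ^+ 2)).
    by rewrite lerXn2r // nnegrE ?sqr_ge0 // mulr_ge0 // ltW.
  rewrite exprMn ler_wpM2l ?sqr_ge0 //; apply: le_trans V2 _.
  have -> : 144 * kappa * b ^+ 6 * n ^+ 8 = (8 * b ^+ 2 * n ^+ 3) * (18 * kappa * b ^+ 4 * n ^+ 5) by ring.
  apply: ler_pM => //.
    by apply: sumr_ge0 => z _; exact: sqr_ge0.
  apply: sumr_ge0 => z _; apply: sumr_ge0 => y _; apply: sumr_ge0 => y' _.
  by rewrite mulr_ge0 ?sqr_ge0 // mulr_ge0.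
have low4 : (al * cA ^+ 2) ^+ 4 <= (6 * n) ^+ 4 * E ^+ 4.
  have h : (al * cA ^+ 2) ^+ 4 <= (6 * n * - E) ^+ 4.
    have h0 : 0 <= al * cA ^+ 2 by rewrite mulr_ge0 ?sqr_ge0 // ltW.
    by rewrite lerXn2r // nnegrE (le_trans h0).
  apply: le_trans h _; rewrite exprMn.
  by rewrite (_ : (- E) ^+ 4 = E ^+ 4) // -[LHS]mul1r; ring.
have := le_trans low4 (ler_wpM2l (exprn_ge0 4 (mulr_ge0 (ler0n _ 6) (ltW n0))) E4).
(* Four powers of [al] come from the main term and six from [cA = al * b * n ^ 2]. On the other side
   [6 ^ 4 * 144 = 2 ^ 8 * 729 < 2 ^ 18], which explains the constant in the hypothesis on
   [kappa]. *)
have -> : (al * cA ^+ 2) ^+ 4 = al ^+ 10 * (cA ^+ 2 * b ^+ 6 * n ^+ 12).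
  have -> : (al * cA ^+ 2) ^+ 4 = al ^+ 4 * cA ^+ 2 * cA ^+ 6 by ring.
  by rewrite -{2}alE -bE; ring.
have -> : (6 * n) ^+ 4 * (cA ^+ 2 * (144 * kappa * b ^+ 6 * n ^+ 8)) =
   (2 ^+ 8 * 729) * kappa * (cA ^+ 2 * b ^+ 6 * n ^+ 12) by ring.
rewrite ler_pM2r; last first.
  by rewrite mulr_gt0 ?(exprn_gt0 _ n0) // mulr_gt0 ?(exprn_gt0 _ b0) ?(exprn_gt0 _ cA0).
have -> : 2 ^+ 8 * 729 * kappa = 729 * (2 ^+ 8 * kappa) by ring.
have e : 2 ^+ 18 * kappa = 1024 * (2 ^+ 8 * kappa) by ring.
have k8 : 0 < 2 ^+ 8 * kappa by rewrite mulr_gt0 // exprn_gt0.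
rewrite e in kal; move: (2 ^+ 8 * kappa) k8 kal => q; lra.
Qed.

End Counting.

(** * The inverse theorem for the box norm *)

Section Rectangles.
Variables (R : realFieldType) (G : finZmodType).
Implicit Types (X Y : pred G) (f : G -> G -> R).

Definition rect_sum f X Y : R := \sum_x \sum_y (X x)%:R * (Y y)%:R * f x y.

Lemma two_valued_sum f (u v : G -> R) (c1 c2 d1 d2 : R) X1 X2 Y1 Y2 :
  (forall x y, u x * v y * f x y =
     (c1 * (X1 x)%:R + c2 * (X2 x)%:R) * (d1 * (Y1 y)%:R + d2 * (Y2 y)%:R) * f x y) ->
  `|c1| <= 1 -> `|c2| <= 1 -> `|d1| <= 1 -> `|d2| <= 1 ->
  \sum_x \sum_y u x * v y * f x y <=
  `|rect_sum f X1 Y1| + `|rect_sum f X1 Y2|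
  + (`|rect_sum f X2 Y1| + `|rect_sum f X2 Y2|).
Proof.
move=> E hc1 hc2 hd1 hd2.
have -> : \sum_x \sum_y u x * v y * f x y =
  c1 * d1 * rect_sum f X1 Y1 + c1 * d2 * rect_sum f X1 Y2
  + (c2 * d1 * rect_sum f X2 Y1 + c2 * d2 * rect_sum f X2 Y2).
  rewrite /rect_sum !mulr_sumr -!big_split /=; apply: eq_bigr => x _.
  rewrite !mulr_sumr -!big_split /=; apply: eq_bigr => y _.
  by rewrite E; ring.
have K (c d S : R) : `|c| <= 1 -> `|d| <= 1 -> c * d * S <= `|S|.
  move=> hc hd; apply: le_trans (ler_norm _) _.
  by rewrite !normrM ler_piMl // mulr_ile1.
by rewrite !lerD // K.
Qed.

Lemma rect_sum_split f X Y X1 Y1 :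
  (forall x, X1 x -> X x) -> (forall y, Y1 y -> Y y) ->
  rect_sum f X Y = rect_sum f X1 Y1 + rect_sum f [pred x | X x && ~~ X1 x] Y1
   + rect_sum f X [pred y | Y y && ~~ Y1 y].
Proof.
move=> sX sY; rewrite /rect_sum -!big_split /=; apply: eq_bigr => x _.
rewrite -!big_split /=; apply: eq_bigr => y _.
have := sX x; have := sY y.
case: (X x); case: (Y y); case: (X1 x); case: (Y1 y) => //=;
  try by [move=> /(_ isT) | move=> _ /(_ isT)].
all: by rewrite !(mul0r, mul1r, mulr0, mulr1, addr0, add0r).
Qed.

(** If [X1 * Y1] carries at most [- 2 * e], the rest of [X * Y] carries at least [2 * e] because the
    total is zero; the rest is two rectangles, one of which carries [e]. *)
Lemma rect_sum_pos f X Y X1 Y1 (e : R) :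
  (forall x, X1 x -> X x) -> (forall y, Y1 y -> Y y) ->
  rect_sum f X Y = 0 -> 0 <= e -> 2 * e <= `|rect_sum f X1 Y1| ->
  exists X' Y' : pred G, [/\ forall x, X' x -> X x, forall y, Y' y -> Y y &
    e <= rect_sum f X' Y'].
Proof.
move=> sX sY f0 e0 h.
have [p|np] := leP e (rect_sum f X1 Y1); first by exists X1, Y1.
have : rect_sum f X1 Y1 <= - (2 * e).
  by move: h; case: (ger0P (rect_sum f X1 Y1)) => h1 h2; lra.
move: f0; rewrite (rect_sum_split f sX sY) => f0 h1.
have [p|np'] := leP e (rect_sum f [pred x | X x && ~~ X1 x] Y1).
  by exists [pred x | X x && ~~ X1 x], Y1; split => // x /andP[].
exists X, [pred y | Y y && ~~ Y1 y]; split => //; first by move=> y /andP[].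
by lra.
Qed.

End Rectangles.

Section BoxInverse.
Variables (R : realFieldType) (G : finZmodType).
Variables (I X Y : pred G) (A : rel G).
Hypothesis (AXY : forall x y, A x y -> X x && Y y).

Let cX : R := \sum_x (X x)%:R.
Let cY : R := \sum_x (Y x)%:R.
Let bal (al : R) x y : R := (A x y)%:R - al * ((X x)%:R * (Y y)%:R).

(** The box norm is a sum of [T x' y'] over [X * Y], so some pair exceeds the average
    [kappa * (cX * cY)]. With this pair fixed, [bal al x y'] on [X] and [bal al x' y] on [Y] take
    only the values [1 - al] and [- al]. Hence [T x' y'] is a combination of four rectangle sums
    with coefficients at most 1, one of which has size [kappa / 4]; a positive sign costs another
    factor 2. *)
Lemma box_inverse (al kappa : R) (z : G) :
  0 <= al <= 1 -> 0 < kappa ->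
  al * (cX * cY) = \sum_x \sum_y (A x y)%:R ->
  kappa * (cX * cY) ^+ 2 < box (fun x => (I x)%:R) (bal al) z ->
  exists X' Y' : pred G, [/\ forall x, X' x -> X x, forall y, Y' y -> Y y &
    kappa / 8 * (cX * cY) <= rect_sum (bal al) X' Y'].
Proof.
move=> /andP[al0 al1] k0 alE hbox.
have cX0 : 0 <= cX by exact: sumr_ge0.
have cY0 : 0 <= cY by exact: sumr_ge0.
have f0 x y : ~~ (X x && Y y) -> bal al x y = 0.
  move=> n; rewrite /bal; case Axy: (A x y); first by rewrite AXY in n.
  by move: n; case: (X x); case: (Y y) => // _; rewrite ?(mulr0, mul0r) subr0.
have f1 x y : `|bal al x y| <= 1.
  have [|n] := boolP (X x && Y y); last by rewrite f0 // normr0.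
  case/andP => Xx Yy; rewrite /bal Xx Yy !mulr1.
  by case: (A x y); rewrite ler_norml; apply/andP; split; rewrite /=; lra.
pose T x' y' : R := \sum_x \sum_y
  ((I (z - x))%:R * (I (z - x'))%:R * (I (z - y'))%:R * bal al x y' * bal al x' y') *
  ((I (z - y))%:R * bal al x' y) * bal al x y.
have [/existsP[p /andP[/andP[Xp Yp] hT]]|/existsPn H] :=
  boolP [exists p : G * G, (X p.1 && Y p.2) && (kappa * (cX * cY) < T p.1 p.2)]; last first.
  exfalso; move: hbox; rewrite ltNge => /negP; apply.
  have -> : box (fun x => (I x)%:R) (bal al) z = \sum_x' \sum_y' T x' y'.
    rewrite /box exchange_big /=; apply: eq_bigr => x' _.
    rewrite exchange_big /=; apply: eq_bigr => x _.
    rewrite expr2 big_distrlr /= mulr_sumr exchange_big /=; apply: eq_bigr => y' _.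
    by rewrite mulr_sumr; apply: eq_bigr => y _; ring.
  have -> : kappa * (cX * cY) ^+ 2 = \sum_x' \sum_y' (X x')%:R * (Y y')%:R * (kappa * (cX * cY)).
    under eq_bigr do under eq_bigr do rewrite -mulrA.
    under eq_bigr do rewrite -mulr_sumr -mulr_suml.
    by rewrite -mulr_suml -/cX -/cY; ring.
  apply: ler_sum => x' _; apply: ler_sum => y' _.
  have := H (x', y'); rewrite negb_and /=.
  case XY: (X x' && Y y') => /=.
    by case/andP: XY => -> ->; rewrite -leNgt !mul1r.
  move=> _; have -> : T x' y' = 0.
    apply: big1 => x _; apply: big1 => y _.
    by rewrite (f0 x' y') ?XY // !(mulr0, mul0r).
  by rewrite !mulr_ge0 // ltW.
case: p Xp Yp hT => x' y' /= Xp Yp hT.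
have fx x : X x -> bal al x y' = (A x y')%:R - al by move=> Xx; rewrite /bal Xx Yp !mulr1.
have fy y : Y y -> bal al x' y = (A x' y)%:R - al by move=> Yy; rewrite /bal Xp Yy !mulr1.
pose c : R := (I (z - x'))%:R * (I (z - y'))%:R * bal al x' y'.
have c1 : `|c| <= 1.
  rewrite /c !normrM !normr_nat; case: (I _); case: (I _); rewrite ?(mul1r,mul0r) ?ler01 //.
pose X1 := [pred x | X x && (I (z - x) && A x y')].
pose X2 := [pred x | X x && (I (z - x) && ~~ A x y')].
pose Y1 := [pred y | Y y && (I (z - y) && A x' y)].
pose Y2 := [pred y | Y y && (I (z - y) && ~~ A x' y)].
pose u x : R := (I (z - x))%:R * (I (z - x'))%:R * (I (z - y'))%:R * bal al x y' * bal al x' y'.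
pose v y : R := (I (z - y))%:R * bal al x' y.
have H2 := @two_valued_sum R G (bal al) u v
   (c * (1 - al)) (c * - al) (1 - al) (- al) X1 X2 Y1 Y2.
have a1 : `|1 - al| <= 1 by rewrite ler_norml; apply/andP; split; lra.
have a2 : `|- al| <= 1 by rewrite ler_norml; apply/andP; split; lra.
have {}H2 : T x' y' <= _ := H2 _ _ _ a1 a2.
have hc (t : R) : `|t| <= 1 -> `|c * t| <= 1 by move=> ?; rewrite normrM mulr_ile1.
have {}H2 := H2 _ (hc _ a1) (hc _ a2).
have E x y : u x * v y * bal al x y = (c * (1 - al) * (X1 x)%:R + c * - al * (X2 x)%:R) *
   ((1 - al) * (Y1 y)%:R + - al * (Y2 y)%:R) * bal al x y.
  have [|n] := boolP (X x && Y y); last by rewrite f0 // !mulr0.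
  case/andP => Xx Yy; rewrite /u /v (fx _ Xx) (fy _ Yy) /= Xx Yy /= /c.
  by case: (I (z - x)); case: (I (z - y)); case: (A x y'); case: (A x' y) => /=; ring.
have {H2 E}hT4 := lt_le_trans hT (H2 E).
have tot : rect_sum (bal al) X Y = 0.
  rewrite /rect_sum.
  have -> : \sum_x \sum_y (X x)%:R * (Y y)%:R * bal al x y =
     \sum_x \sum_y ((A x y)%:R - al * ((X x)%:R * (Y y)%:R)).
    apply: eq_bigr => x _; apply: eq_bigr => y _.
    have [|n] := boolP (X x && Y y); last by rewrite f0 // mulr0 -/(bal al x y) f0.
    by case/andP => Xx Yy; rewrite /bal Xx Yy !mul1r.
  under eq_bigr do rewrite sumrB -mulr_sumr -mulr_sumr.
  by rewrite sumrB -mulr_sumr -mulr_suml alE subrr.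
have sX1 x : X1 x -> X x by case/andP.
have sX2 x : X2 x -> X x by case/andP.
have sY1 y : Y1 y -> Y y by case/andP.
have sY2 y : Y2 y -> Y y by case/andP.
have e0 : 0 <= kappa / 8 * (cX * cY) 
  by rewrite mulr_ge0 ?divr_ge0 ?mulr_ge0 // ltW.
have fin (X' Y' : pred G) : (forall x, X' x -> X x) -> (forall y, Y' y -> Y y) ->
  kappa / 4 * (cX * cY) <= `|rect_sum (bal al) X' Y'| -> exists X' Y' : pred G,
  [/\ forall x, X' x -> X x, forall y, Y' y -> Y y &
    kappa / 8 * (cX * cY) <= rect_sum (bal al) X' Y'].
  move=> sX sY hr; apply: (rect_sum_pos sX sY tot e0).
  by apply: le_trans hr; rewrite mulrA ler_wpM2r ?mulr_ge0 //; lra.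
have [p11|p11] := leP (kappa / 4 * (cX * cY)) `|rect_sum (bal al) X1 Y1|; first exact: fin p11.
have [p12|p12] := leP (kappa / 4 * (cX * cY)) `|rect_sum (bal al) X1 Y2|; first exact: fin p12.
have [p21|p21] := leP (kappa / 4 * (cX * cY)) `|rect_sum (bal al) X2 Y1|; first exact: fin p21.
have [p22|p22] := leP (kappa / 4 * (cX * cY)) `|rect_sum (bal al) X2 Y2|; first exact: fin p22.
exfalso.
have := lt_trans hT4 (ltrD (ltrD p11 p12) (ltrD p21 p22)).
have -> : kappa / 4 * (cX * cY) + kappa / 4 * (cX * cY) +
  (kappa / 4 * (cX * cY) + kappa / 4 * (cX * cY)) = kappa * (cX * cY) by field.
by rewrite ltxx.
Qed.

End BoxInverse.

Section Increment.
Variables (R : realFieldType) (G : finZmodType).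
Variables (I X Y : pred G) (A : rel G).
Hypotheses (XI : forall x, X x -> I x) (YI : forall y, Y y -> I y).
Hypothesis (AXY : forall x y, A x y -> X x && Y y).
Hypothesis (cornerfree : forall x y d, A x y -> A (x + d) y -> A x (y + d) -> d = 0).

Let n : R := \sum_x (I x)%:R.
Let cX : R := \sum_x (X x)%:R.
Let cY : R := \sum_x (Y x)%:R.
Let cA : R := \sum_x \sum_y (A x y)%:R.

Lemma density_increment (al eta kappa : R) :
  #|G|%:R <= 3 * n -> 0 < n -> 0 < cX -> 0 < cY ->
  al * (cX * cY) = cA -> 0 < al -> 0 < eta -> 0 < kappa <= 1 ->
  2 ^+ 18 * kappa <= al ^+ 10 ->
  eta <= kappa * (cX * cY / n ^+ 2) ^+ 4 ->
  6 <= al ^+ 2 * (cX * cY / n ^+ 2) * n ->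
  u2 (fun x => (X x)%:R - cX / n * (I x)%:R) <= eta ^+ 2 * n ^+ 3 ->
  u2 (fun x => (Y x)%:R - cY / n * (I x)%:R) <= eta ^+ 2 * n ^+ 3 ->
  exists X' Y' : pred G, [/\ forall x, X' x -> X x, forall y, Y' y -> Y y &
    al * ((\sum_x (X' x)%:R) * (\sum_y (Y' y)%:R)) + kappa / 8 * (cX * cY) <=
    \sum_x \sum_y ((X' x) && (Y' y) && A x y)%:R].
Proof.
move=> hG n0 cX0 cY0 alE al0 eta0 hk kal etak ngt uX uY.
have cAle : cA <= cX * cY.
  rewrite mulr_suml; apply: ler_sum => x _; rewrite mulr_sumr; apply: ler_sum => y _.
  case Axy: (A x y); last by rewrite mulr_ge0.
  by case/andP: (AXY Axy) => -> ->; rewrite mulr1.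
have al1 : al <= 1 by rewrite -(ler_pM2r (mulr_gt0 cX0 cY0)) alE mul1r.
have [z hz] := box_large XI YI AXY cornerfree hG n0 cX0 cY0 alE al0 eta0 hk kal etak ngt uX uY.
have al01 : 0 <= al <= 1 by rewrite ltW.
have k0 : 0 < kappa by case/andP: hk.
have [X' [Y' [sX sY h]]] := box_inverse AXY al01 k0 alE hz.
exists X', Y'; split=> //.
apply: le_trans (lerD (lexx _) h) _.
rewrite big_distrlr /= mulr_sumr -big_split /=; apply: ler_sum => x _.
rewrite mulr_sumr -big_split /=; apply: ler_sum => y _.
case X'x: (X' x); last by rewrite !(mul0r, mulr0) addr0.
case Y'y: (Y' y); last by rewrite !(mul0r, mulr0) addr0.
by rewrite (sX _ X'x) (sY _ Y'y) !(mul1r, mulr1) /= addrC subrK.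
Qed.

End Increment.

(** * Fourier analysis on a cyclic group *)

Section Fourier.
Variable C : numClosedFieldType.

Lemma prim_root_exists (n : nat) : (0 < n)%N -> exists w : C, n.-primitive_root w.
Proof.
move=> n_gt0; have [rs] := closed_field_poly_normal ('X^n - 1 : {poly C}).
rewrite (monicP (monicXnsubC _ n_gt0)) scale1r => rsE.
have rs_unity : all n.-unity_root rs.
  by apply/allP => z zrs; rewrite /root_of_unity rsE root_prod_XsubC.
have rs_uniq : uniq rs.
  by rewrite -separable_prod_XsubC -rsE separable_Xn_sub_1 // pnatr_eq0 -lt0n.
have rs_size : (n <= size rs)%N.
  by rewrite -ltnS -(size_prod_XsubC rs id) -rsE size_XnsubC.
by case/hasP: (has_prim_root n_gt0 rs_unity rs_uniq rs_size) => w _ wP; exists w.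
Qed.

Lemma unity_norm (n : nat) (w : C) : (0 < n)%N -> w ^+ n = 1 -> `|w| = 1.
Proof.
move=> n0 wn; apply/eqP; rewrite -(@pexpr_eq1 C `|w| n n0) ?normr_ge0 //.
by rewrite -normrX wn normr1.
Qed.

Lemma unity_conj (n : nat) (w : C) : (0 < n)%N -> w ^+ n = 1 -> w * w^* = 1.
Proof. by move=> n0 wn; rewrite -normCK (unity_norm n0 wn) expr1n. Qed.

Variable m : nat.
Local Notation M := m.+1.
Variable w : C.
Hypothesis wP : M.-primitive_root w.
Let wM : w ^+ M = 1 := prim_expr_order wP.

Definition dft (f : 'I_M -> C) (r : nat) : C := \sum_x f x * (w ^+ r) ^+ x.

Lemma sum_unity (x y : 'I_M) :
  \sum_(r < M) (w ^+ r) ^+ x * ((w ^+ r) ^+ y)^* = (x == y)%:R * M%:R.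
Proof.
pose z := w ^+ x * (w ^+ y)^*.
have Ez (r : nat) : (w ^+ r) ^+ x * ((w ^+ r) ^+ y)^* = z ^+ r.
  by rewrite -!exprM exprMn -rmorphXn -!exprM ![(r * _)%N]mulnC.
under eq_bigr do rewrite Ez.
have wyM : (w ^+ y) ^+ M = 1 by rewrite exprAC wM expr1n.
have zM : z ^+ M = 1.
  by rewrite exprMn exprAC wM expr1n mul1r -rmorphXn /= wyM rmorph1.
have [xy|xy] := eqVneq x y.
  have -> : z = 1 by rewrite /z xy (unity_conj _ wyM).
  by under eq_bigr do rewrite expr1n; rewrite sumr_const card_ord mul1r.
rewrite mul0r; have z1 : z != 1.
  apply: contraNneq xy => z1; apply/eqP; apply: val_inj.
  have : w ^+ x == w ^+ y.
    have := congr1 (fun t => t * w ^+ y) z1; rewrite /z mul1r -mulrA [_^* * _]mulrC.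
    by rewrite (unity_conj _ wyM) // mulr1 => ->.
  by rewrite (eq_prim_root_expr wP) !modn_small // => /eqP.
have := subrX1 z M; rewrite zM subrr => /esym/eqP.
by rewrite mulf_eq0 subr_eq0 (negbTE z1) /= => /eqP.
Qed.

Lemma parseval (f : 'I_M -> C) :
  \sum_(r < M) `|dft f r| ^+ 2 = M%:R * \sum_x `|f x| ^+ 2.
Proof.
transitivity (\sum_x \sum_y f x * (f y)^* *
    \sum_(r < M) (w ^+ r) ^+ x * ((w ^+ r) ^+ y)^*).
  under eq_bigr do rewrite normCK /dft rmorph_sum big_distrlr /=.
  rewrite exchange_big /=; apply: eq_bigr => x _.
  rewrite exchange_big /=; apply: eq_bigr => y _.
  rewrite mulr_sumr; apply: eq_bigr => r _.
  by rewrite rmorphM /= -!mulrA; congr (_ * _); rewrite mulrCA.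
rewrite mulr_sumr; apply: eq_bigr => x _.
under eq_bigr do rewrite sum_unity.
rewrite (bigD1 x) //= big1 ?addr0 => [|y yx].
  by rewrite eqxx mul1r normCK mulrC.
by rewrite eq_sym (negbTE yx) mul0r mulr0.
Qed.

Lemma dft_autocorr (f : 'I_M -> C) (r : nat) : (forall x, (f x)^* = f x) ->
  dft (fun t => \sum_x f x * f (x + t)) r = `|dft f r| ^+ 2.
Proof.
move=> fR; rewrite normCK /dft rmorph_sum big_distrlr /=.
have wrM : (w ^+ r) ^+ M = 1 by rewrite exprAC wM expr1n.
under eq_bigr do rewrite mulr_suml.
rewrite exchange_big [RHS]exchange_big /=; apply: eq_bigr => y _.
rewrite [RHS](reindex_inj (addrI y)) /=; apply: eq_bigr => t _.
rewrite rmorphM /= fR.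
rewrite expr_mod // exprD.
have wyM : ((w ^+ r) ^+ y) ^+ M = 1 by rewrite exprAC wrM expr1n.
transitivity (f y * f (y + t) * (w ^+ r) ^+ t * ((w ^+ r) ^+ y * ((w ^+ r) ^+ y)^*)).
  by rewrite (unity_conj _ wyM) // mulr1.
by ring.
Qed.

(** By Parseval the energy is the fourth moment of the Fourier coefficients over [M]. One square is
    bounded by [K], and Parseval evaluates the other. *)
Lemma autocorr_energy_le (f : 'I_M -> C) (K : C) : (forall x, (f x)^* = f x) ->
  (forall v : C, v ^+ M = 1 -> `|\sum_x f x * v ^+ x| ^+ 2 <= K) ->
  \sum_t `|\sum_x f x * f (x + t)| ^+ 2 <= K * \sum_x `|f x| ^+ 2.
Proof.
move=> fR hK.
have M0 : 0 < M%:R :> C by rewrite ltr0n.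
rewrite -(ler_pM2l M0) -parseval mulrCA -parseval mulr_sumr.
apply: ler_sum => r _; rewrite dft_autocorr // normrX normr_id.
rewrite -exprM (exprM _ 2 2) [X in X <= _]expr2.
apply: ler_wpM2r; first by rewrite exprn_ge0.
by apply: hK; rewrite exprAC wM expr1n.
Qed.
End Fourier.

(** * Sliding windows *)

Section Windows.

Definition supported (V : nmodType) (n : nat) (F : int -> V) :=
  forall z : int, ~~ (0 <= z < n%:Z) -> F z = 0.

Lemma sum_window (V : nmodType) (H : nat -> V) (n c m : nat) : (c + n <= m)%N ->
  (forall k, ~~ (c <= k < c + n)%N -> H k = 0) ->
  \sum_(k < m) H k = \sum_(x < n) H (x + c)%N.
Proof.
move=> cnm H0; rewrite -(big_mkord xpredT H) -(big_mkord xpredT (fun x => H (x + c)%N)).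
rewrite (@big_cat_nat _ _ _ c) //=; last exact: leq_trans (leq_addr _ _) cnm.
rewrite (@big_cat_nat _ _ _ (c + n) c) //= ?leq_addr //.
rewrite big_nat_cond big1 ?add0r => [|k /andP[/andP[_ kc] _]]; last first.
  by rewrite H0 // leqNgt kc.
rewrite [X in _ + X]big_nat_cond [X in _ + X]big1 ?addr0 => [|k /andP[/andP[kc _] _]]; last first.
  by rewrite H0 // [(k < _)%N]ltnNge kc andbF.
by rewrite -{1}[c]add0n big_addn addKn.
Qed.

(** Windows are read downwards from [k], so that the naturals below [n + q * L] index every window
    meeting a cell of length [n]. *)
Definition wsum (V : nmodType) (F : int -> V) (q L k : nat) : V :=
  \sum_(j < L) F (k%:Z - (q * j)%N%:Z).

(** Substitute [k = x + q * j]: with the overhanging windows included, each pair [(x, j)] occurs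
    exactly once. *)
Lemma sum_window_weight (C : pzSemiRingType) (F : int -> C) (g : nat -> C) (n q L : nat) :
  supported n F ->
  \sum_(k < n + q * L) wsum F q L k * g k =
  \sum_(x < n) \sum_(j < L) F x%:Z * g (x + q * j)%N.
Proof.
move=> F0; rewrite [RHS]exchange_big /=.
under eq_bigr do rewrite mulr_suml.
rewrite exchange_big /=; apply: eq_bigr => j _.
rewrite (@sum_window _ (fun k => F (k%:Z - (q * j)%N%:Z) * g k) n (q * j)) //.
- by apply: eq_bigr => x _; rewrite PoszD addrK.
- by rewrite addnC leq_add2l leq_mul2l ltnW ?orbT.
by move=> k hk; rewrite F0 ?mul0r //; apply: contra hk; lia.
Qed.

Lemma sum_wsum (C : pzSemiRingType) (F : int -> C) (n q L : nat) : supported n F ->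
  \sum_(k < n + q * L) wsum F q L k = L%:R * \sum_(x < n) F x%:Z.
Proof.
move=> F0; have := @sum_window_weight C F (fun=> 1) n q L F0.
under eq_bigr do rewrite mulr1; move=> ->.
under eq_bigr do under eq_bigr do rewrite mulr1.
by rewrite mulr_sumr; apply: eq_bigr => x _; rewrite sumr_const card_ord mulr_natl.
Qed.

End Windows.

(** * Dirichlet's theorem and the variance along windows *)

Section Dirichlet.
Variable R : realType.
Local Notation C := (R[i]).
Local Notation "x %:C" := (real_complex R x).

Lemma norm_realC (x : R) : `|x%:C| = `|x|%:C :> C.
Proof. by rewrite normc_def /= expr0n /= addr0 sqrtr_sqr. Qed.

(** All the powers involved stay within [1 / 2] of 1. *)
Lemma unit_geometric_lower (v : C) (L : nat) : `|v| = 1 -> 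
  `|v - 1| * (2 * L%:R) <= 1 -> L%:R / 2 <= `|\sum_(j < L) v ^+ j|.
Proof.
move=> v1 hv.
have hj (j : nat) : `|v ^+ j - 1| <= j%:R * `|v - 1|.
  elim: j => [|j IH]; first by rewrite expr0 subrr normr0 mul0r.
  have -> : v ^+ j.+1 - 1 = v * (v ^+ j - 1) + (v - 1) by rewrite exprS; ring.
  apply: le_trans (ler_normD _ _) _; rewrite normrM v1 mul1r.
  by rewrite -natr1 mulrDl mul1r lerD2r.
have h : `|\sum_(j < L) (v ^+ j - 1)| <= L%:R / 2.
  apply: le_trans (ler_norm_sum _ _ _) _.
  apply: (@le_trans _ _ (\sum_(j < L) 2^-1)).
    apply: ler_sum => j _; apply: le_trans (hj j) _.
    rewrite -(@ler_pM2r _ 2) // mulVf ?pnatr_eq0 //; apply: le_trans hv.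
    rewrite mulrAC mulrC [2 * _]mulrC; apply: ler_wpM2l => //.
    by rewrite ler_wpM2r // ler_nat ltnW.
  by rewrite sumr_const card_ord mulr_natl.
have E : L%:R = \sum_(j < L) v ^+ j - \sum_(j < L) (v ^+ j - 1) :> C.
  by rewrite sumrB sumr_const card_ord opprB addrCA subrr addr0.
have h2 : L%:R <= `|\sum_(j < L) v ^+ j| + `|\sum_(j < L) (v ^+ j - 1)| :> C.
  by rewrite -[X in X <= _]normr_nat {1}E ler_normB.
have := le_trans h2 (lerD (lexx _) h).
rewrite -lerBlDr; apply: le_trans.
by rewrite {2}[L%:R](splitr) addrK.
Qed.

(** Pigeonhole: real and imaginary parts sort the powers of [w] into [(8 * L + 1) ^ 2] squares of
    side [1 / (4 * L)]. Two powers in one square are within [1 / (2 * L)], and their exponents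
    differ by [q]. *)
Lemma unit_return (w : C) (L : nat) : `|w| = 1 -> (0 < L)%N ->
  exists q : nat, [/\ (0 < q)%N, (q <= (8 * L).+1 ^ 2)%N & `|w ^+ q - 1| * (2 * L%:R) <= 1].
Proof.
move=> w1 L0; set K := (8 * L)%N.
have rng (x : R) : -1 <= x <= 1 -> (Num.truncn ((x + 1) * (4 * L%:R)) < K.+1)%N.
  move=> /andP[x0 x1]; rewrite ltnS truncn_le_nat.
  apply: (@le_lt_trans _ _ (2 * (4 * L%:R))).
    by apply: ler_wpM2r; [rewrite mulr_ge0 | lra].
  by rewrite mulrA -natrM -natrM ltr_nat ltnS.
have wn j : `|w ^+ j| = 1 by rewrite normrX w1 expr1n.
have reim j : complex.Re (w ^+ j) ^+ 2 + complex.Im (w ^+ j) ^+ 2 = 1.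
  by apply: (@complexI R); rewrite add_Re2_Im2 wn expr1n.
have sq1 (x y : R) : x ^+ 2 + y ^+ 2 = 1 -> -1 <= x <= 1.
  move=> e; have : x ^+ 2 <= 1 by rewrite -e lerDl sqr_ge0.
  by rewrite -[1 in X in X -> _](expr1n _ 2) -real_normK ?num_real // ler_sqr ?nnegrE // ler_norml.
have re1 j : -1 <= complex.Re (w ^+ j) <= 1 by exact: sq1 (reim j).
have im1 j : -1 <= complex.Im (w ^+ j) <= 1 by apply: sq1 (complex.Re (w ^+ j)) _; rewrite addrC.
pose cell (j : 'I_(K.+1 ^ 2).+1) : 'I_K.+1 * 'I_K.+1 :=
  (Ordinal (rng _ (re1 j)), Ordinal (rng _ (im1 j))).
have : ~~ injectiveb cell.
  apply/injectiveP => /leq_card; rewrite card_prod !card_ord.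
  by rewrite mulnn ltnn.
case/injectivePn => i [j ij cij].
wlog lt_ij : i j ij cij / (i < j)%N.
  move=> W; case: (ltngtP i j) => h; first exact: W h.
    by apply: (W j i) => //; rewrite eq_sym.
  by move/val_inj: h ij => ->; rewrite eqxx.
have close (x y : R) (hx : -1 <= x <= 1) (hy : -1 <= y <= 1) :
    Num.truncn ((x + 1) * (4 * L%:R)) = Num.truncn ((y + 1) * (4 * L%:R)) ->
    `|x - y| * (4 * L%:R) <= 1.
  move=> e.
  have p (t : R) : -1 <= t <= 1 -> 0 <= (t + 1) * (4 * L%:R).
    by move=> /andP[t0 _]; rewrite !mulr_ge0 //; lra.
  have := truncn_itv (p x hx); have := truncn_itv (p y hy); rewrite e.
  move: (Num.truncn _) => k /andP[a b] /andP[c d].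
  rewrite -[4 * _]ger0_norm ?mulr_ge0 // -normrM mulrBl ler_norml.
  by rewrite -natr1 in b d; apply/andP; split; lra.
have hre := close _ _ (re1 i) (re1 j) (congr1 (fun p => val p.1) cij).
have him := close _ _ (im1 i) (im1 j) (congr1 (fun p => val p.2) cij).
exists (j - i)%N; split; first by rewrite subn_gt0.
  by rewrite (leq_trans (leq_subr _ _)) // -ltnS.
have -> : `|w ^+ (j - i) - 1| = `|w ^+ i - w ^+ j|.
  have e : w ^+ j = w ^+ i * w ^+ (j - i) by rewrite -exprD subnKC // ltnW.
  have -> : w ^+ i - w ^+ j = w ^+ i * (1 - w ^+ (j - i)) by rewrite e mulrBr mulr1.
  by rewrite normrM wn mul1r distrC.
rewrite [_ - _]complexE.
have Re_sub : complex.Re (w ^+ i - w ^+ j) = complex.Re (w ^+ i) - complex.Re (w ^+ j) by case: (w ^+ i); case: (w ^+ j).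
have Im_sub : complex.Im (w ^+ i - w ^+ j) = complex.Im (w ^+ i) - complex.Im (w ^+ j) by case: (w ^+ i); case: (w ^+ j).
apply: (@le_trans _ _ ((`|complex.Re (w ^+ i) - complex.Re (w ^+ j)| + `|complex.Im (w ^+ i) - complex.Im (w ^+ j)|)%:C * (2 * L%:R))).
  apply: ler_wpM2r; first by rewrite mulr_ge0.
  apply: le_trans (ler_normD _ _) _.
  rewrite Re_sub Im_sub normrM !norm_realC rmorphD lerD //=.
  rewrite ler_piMl //; first by rewrite ler0c.
  by rewrite normc_def /= expr0n add0r expr1n sqrtr1.
have -> : (2 * L%:R : C) = (2 * L%:R)%:C by rewrite rmorphM /= !rmorph_nat.
rewrite -rmorphM; have -> : 1 = 1%:C :> C by [].
by rewrite lecR; lra.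
Qed.

(* A large Fourier coefficient at [w] gives a large variance along the windows
   [{k - q j : j < L}] as soon as [w ^ q] is close to [1]. *)
Lemma fourier_wsum (u : int -> R) (n L : nat) (w : C) (K : R) :
  supported n u -> `|w| = 1 -> (0 < L)%N ->
  K%:C <= `|\sum_(x < n) (u x%:Z)%:C * w ^+ x| ^+ 2 ->
  exists q : nat, [/\ (0 < q)%N, (q <= (8 * L).+1 ^ 2)%N &
    L%:R ^+ 2 / 4 * K <= (n + q * L)%:R * \sum_(k < n + q * L) wsum u q L k ^+ 2].
Proof.
move=> u0 w1 L0 hK; have [q [q0 qL hq]] := unit_return w1 L0.
exists q; split => //; set m := (n + q * L)%N.
have wq1 : `|w ^+ q| = 1 by rewrite normrX w1 expr1n.
have hL := unit_geometric_lower wq1 hq.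
set f := \sum_(x < n) _ in hK.
have E : \sum_(k < m) (wsum u q L k)%:C * w ^+ k = f * \sum_(j < L) (w ^+ q) ^+ j.
  have := @sum_window_weight C (fun z => (u z)%:C) (fun k => w ^+ k) n q L.
  have W k : wsum (fun z => (u z)%:C) q L k = (wsum u q L k)%:C by rewrite /wsum rmorph_sum.
  under eq_bigr do rewrite W.
  move=> ->; last by move=> z hz; rewrite u0.
  rewrite /f mulr_suml; apply: eq_bigr => x _; rewrite mulr_sumr.
  by apply: eq_bigr => j _; rewrite -mulrA exprD exprM.
have h1 : `|f| * (L%:R / 2) <= (\sum_(k < m) `|wsum u q L k|)%:C.
  apply: (@le_trans _ _ (`|f| * `|\sum_(j < L) (w ^+ q) ^+ j|)); first exact: ler_wpM2l.
  rewrite -normrM -E rmorph_sum /=; apply: le_trans (ler_norm_sum _ _ _) _.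
  by apply: ler_sum => k _; rewrite normrM normrX w1 expr1n mulr1 norm_realC.
have h2 : (`|f| * (L%:R / 2)) ^+ 2 <= ((\sum_(k < m) `|wsum u q L k|) ^+ 2)%:C.
  have s0 : 0 <= (\sum_(k < m) `|wsum u q L k|)%:C by rewrite ler0c sumr_ge0.
  rewrite rmorphXn /= lerXn2r // nnegrE.
  by rewrite mulr_ge0 // divr_ge0.
have h3 : (L%:R ^+ 2 / 4 * K)%:C <= ((\sum_(k < m) `|wsum u q L k|) ^+ 2)%:C.
  apply: le_trans h2.
  have -> : (L%:R ^+ 2 / 4 * K)%:C = (L%:R ^+ 2 / 4) * K%:C.
    by rewrite rmorphM /= rmorphM /= fmorphV /= rmorphXn /= !rmorph_nat.
  have -> : (`|f| * (L%:R / 2)) ^+ 2 = (L%:R ^+ 2 / 4) * `|f| ^+ 2 by field.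
  by apply: ler_wpM2l hK; rewrite divr_ge0 // exprn_ge0.
rewrite lecR in h3; apply: le_trans h3 _.
apply: le_trans (sqr_sum_ord m (fun k => `|wsum u q L k|)) _.
apply: ler_wpM2l => //; apply: ler_sum => k _.
by rewrite real_normK // num_real.
Qed.

End Dirichlet.

(** * Cells and their energy *)

Section Cells.
Variable R : realType.
Implicit Types (X Y : pred int) (A : rel int).

Definition cnt X (n : nat) : R := \sum_(x < n) (X x%:Z)%:R.
Definition cnt2 A (n : nat) : R := \sum_(x < n) \sum_(y < n) (A x%:Z y%:Z)%:R.

(** Modulo [2 * n + 1] distinct differences of points below [n] stay distinct. Squaring [eta] makes
    the error in [sum_sqr_conv_le] linear in [eta]. *)
Definition uniform (eta : R) (n : nat) X : Prop :=
  u2 (fun x : 'I_(2 * n).+1 => (X (val x)%:Z)%:R - cnt X n / n%:R * (val x < n)%:R)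
  <= eta ^+ 2 * n%:R ^+ 3.

(** Both signs of [d] are excluded, since windows reverse orientation and the cyclic group has no
    order. *)
Definition corner_free A :=
  forall x y d : int, A x y -> A (x + d) y -> A x (y + d) -> d = 0.

Definition cell (n : nat) X Y A : Prop :=
  [/\ forall z, X z -> 0 <= z < n%:Z, forall z, Y z -> 0 <= z < n%:Z,
      forall x y, A x y -> X x && Y y & corner_free A].

Definition subset_window (q L k : nat) X : pred int :=
  fun z => (0 <= z < L%:Z) && X (k%:Z - q%:Z * z).

Definition subset_window2 (q L k l : nat) A : rel int :=
  fun z w => [&& 0 <= z < L%:Z, 0 <= w < L%:Z & A (k%:Z - q%:Z * z) (l%:Z - q%:Z * w)].

(** A corner of difference [d] in the window pair is one of difference [- q * d] in the cell. The
    shifts [k] and [l] are independent, but [q] is shared. *)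
Lemma cell_window (n q L k l : nat) X Y A : (0 < q)%N -> cell n X Y A ->
  cell L (subset_window q L k X) (subset_window q L l Y) (subset_window2 q L k l A).
Proof.
move=> q0 [hX hY hA hc]; split=> [z /andP[]|z /andP[]|x y /and3P[hx hy /hA /andP[Xx Yy]]|] //.
  by rewrite /subset_window hx hy Xx.
move=> x y d /and3P[_ _ a0] /and3P[_ _ a1] /and3P[_ _ a2].
have e (u v : int) : u - q%:Z * (v + d) = u - q%:Z * v + - (q%:Z * d) by ring.
rewrite e in a1; rewrite e in a2; have /eqP := hc _ _ _ a0 a1 a2.
by rewrite oppr_eq0 mulf_eq0 => /orP[/eqP|/eqP//]; lia.
Qed.

Lemma cnt_ge0 X n : 0 <= cnt X n. Proof. exact: sumr_ge0. Qed.

Lemma cnt_le X n : cnt X n <= n%:R.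
Proof.
apply: (@le_trans _ _ (\sum_(x < n) 1)); last by rewrite sumr_const card_ord.
by apply: ler_sum => x _; case: (X _).
Qed.

Lemma cnt2_le_mul n X Y A : cell n X Y A -> cnt2 A n <= cnt X n * cnt Y n.
Proof.
case=> _ _ hA _; rewrite mulr_suml; apply: ler_sum => x _.
rewrite mulr_sumr; apply: ler_sum => y _; case Axy: (A _ _); last by rewrite mulr_ge0.
by case/andP: (hA _ _ Axy) => -> ->; rewrite mulr1.
Qed.

Lemma cnt_window (q L k : nat) X :
  cnt (subset_window q L k X) L = wsum (fun z => (X z)%:R : R) q L k.
Proof.
by apply: eq_bigr => j _; rewrite /subset_window PoszM ltz_nat ltn_ord.
Qed.

Lemma supported_pred n X : (forall z, X z -> 0 <= z < n%:Z) ->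
  supported n (fun z => (X z)%:R : R).
Proof. by move=> hX z hz; case Xz: (X z) => //; rewrite hX in hz. Qed.

Lemma sum_cnt_window n q L X : (forall z, X z -> 0 <= z < n%:Z) ->
  \sum_(k < n + q * L) cnt (subset_window q L k X) L = L%:R * cnt X n.
Proof.
move=> hX; under eq_bigr do rewrite cnt_window.
exact: sum_wsum (supported_pred hX).
Qed.

Lemma sum_cnt2_window n q L X Y A : cell n X Y A ->
  \sum_(k < n + q * L) \sum_(l < n + q * L) cnt2 (subset_window2 q L k l A) L
  = L%:R ^+ 2 * cnt2 A n.
Proof.
case=> hX hY hA _.
pose F z : R := \sum_(y < n) (A z y%:Z)%:R.
have F0 : supported n F.
  move=> z hz; apply: big1 => y _; case Azy: (A _ _) => //.
  by case/andP: (hA _ _ Azy) => /hX; rewrite (negbTE hz).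
have E (k : nat) : \sum_(l < n + q * L) cnt2 (subset_window2 q L k l A) L
    = L%:R * wsum F q L k.
  rewrite /wsum mulr_sumr /cnt2 exchange_big /=; apply: eq_bigr => i _.
  have G0 : supported n (fun w => (A (k%:Z - (q * i)%N%:Z) w)%:R : R).
    move=> w hw; case Aw: (A _ _) => //.
    by case/andP: (hA _ _ Aw) => _ /hY; rewrite (negbTE hw).
  rewrite -(sum_wsum q L G0); apply: eq_bigr => l _; apply: eq_bigr => j _.
  by rewrite /subset_window2 !PoszM !ltz_nat !ltn_ord.
under eq_bigr do rewrite E.
by rewrite -mulr_sumr (sum_wsum q L F0) mulrA -expr2.
Qed.

(** Cauchy-Schwarz: for any [q] the mean squared density is kept up to the overhang. This serves the
    side whose non-uniformity did not dictate [q]. *)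
Lemma window_energy_any n q L X : (forall z, X z -> 0 <= z < n%:Z) -> 
  (L%:R * cnt X n) ^+ 2 <= (n + q * L)%:R * \sum_(k < n + q * L) cnt (subset_window q L k X) L ^+ 2.
Proof.
move=> hX; rewrite -(sum_cnt_window q L hX).
exact: (sqr_sum_ord (n + q * L) (fun k => cnt (subset_window q L k X) L)).
Qed.

Lemma sum_ord_widen (F : nat -> R) (n m : nat) : (n <= m)%N ->
  (forall k, (n <= k)%N -> F k = 0) -> \sum_(k < m) F k = \sum_(k < n) F k.
Proof.
move=> nm F0; rewrite (@sum_window _ F n 0) // => [|k].
  by apply: eq_bigr => k _; rewrite addn0.
by rewrite /= -leqNgt => /F0.
Qed.

Definition balanced n X (z : int) : R :=
  (X z)%:R - cnt X n / n%:R * (0 <= z < n%:Z)%R%:R.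

(** Contrapositive of [autocorr_energy_le], as the balanced function has energy at most [n]. *)
Lemma nonuniform_fourier (eta : R) n X : (0 < n)%N -> (forall z, X z -> 0 <= z < n%:Z) ->
  ~ uniform eta n X ->
  exists2 w : R[i], `|w| = 1 & real_complex R (eta ^+ 2 * n%:R ^+ 2) <=
    `|\sum_(x < n) real_complex R (balanced n X x%:Z) * w ^+ x| ^+ 2.
Proof.
move=> n0 hX nu; apply: contrapT => /forall2NP H; apply: nu.
rewrite /balanced in H; set b := cnt X n / n%:R in H *.
have b01 : 0 <= b <= 1.
  by rewrite divr_ge0 ?cnt_ge0 //= ler_pdivrMr ?ltr0n // mul1r cnt_le.
pose f (x : 'I_(2 * n).+1) : R := (X (val x)%:Z)%:R - b * (val x < n)%:R.
have [w0 w0P] := prim_root_exists (R[i]) (ltn0Sn (2 * n)).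
have := @autocorr_energy_le (R[i]) (2 * n) w0 w0P (fun x => real_complex R (f x))
   (real_complex R (eta ^+ 2 * n%:R ^+ 2)).
have fR x : (real_complex R (f x))^* = real_complex R (f x).
  by apply/CrealP; rewrite complex_real.
move=> /(_ fR) H2.
have {H2} : \sum_t `|\sum_x real_complex R (f x) * real_complex R (f (x + t))| ^+ 2 <=
   real_complex R (eta ^+ 2 * n%:R ^+ 2) * \sum_x `|real_complex R (f x)| ^+ 2.
  apply: H2 => v vM; have v1 : `|v| = 1 by exact: unity_norm vM.
  have [//|] := H v => {}H.
  rewrite real_leNgt ?realX ?normr_real ?complex_real //; apply/negP => /ltW h.
  apply: H; apply: le_trans h _; rewrite le_eqVlt; apply/orP; left; apply/eqP.
  congr (`| _ | ^+ 2).
  transitivity (\sum_(x < (2 * n).+1) real_complex R ((X x%:Z)%:R - b * (x < n)%:R) * v ^+ x) => //.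
  rewrite (@sum_window _ (fun x => real_complex R ((X x%:Z)%:R - b * (x < n)%:R) * v ^+ x) n 0).
  - by apply: eq_bigr => x _; rewrite addn0 ltz_nat.
  - by rewrite add0n mul2n -addnn ltnW // ltnS leq_addr.
  move=> k /=; rewrite add0n => kn; rewrite (negbTE kn) mulr0 subr0.
  case Xk: (X _); last by rewrite mul0r.
  by have := hX _ Xk; rewrite ltz_nat (negbTE kn) andbF.
have -> : \sum_t `|\sum_x real_complex R (f x) * real_complex R (f (x + t))| ^+ 2 = real_complex R (u2 f).
  rewrite /u2 rmorph_sum; apply: eq_bigr => t _.
  have -> : \sum_x real_complex R (f x) * real_complex R (f (x + t))
     = real_complex R (\sum_x f x * f (x + t)).
    by rewrite rmorph_sum; apply: eq_bigr => x _; rewrite rmorphM.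
  by rewrite norm_realC -rmorphXn real_normK // num_real.
have -> : \sum_x `|real_complex R (f x)| ^+ 2 = real_complex R (\sum_x f x ^+ 2).
  rewrite rmorph_sum; apply: eq_bigr => t _.
  by rewrite norm_realC -rmorphXn real_normK // num_real.
rewrite -rmorphM lecR => /le_trans; apply.
rewrite [n%:R ^+ 3]exprSr mulrA; apply: ler_wpM2l; first by rewrite mulr_ge0 ?sqr_ge0.
have := @sum_ord_widen (fun x => ((X x%:Z)%:R - b * (x < n)%:R) ^+ 2) n (2 * n).+1.
move=> ->; last first.
- move=> k kn; rewrite ltnNge kn mulr0 subr0; case Xk: (X _); last by rewrite expr0n.
  by have := hX _ Xk; rewrite ltz_nat ltnNge kn andbF.
- by rewrite mul2n -addnn ltnW // ltnS leq_addr.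
apply: (@le_trans _ _ (\sum_(x < n) 1)); last by rewrite sumr_const card_ord.
apply: ler_sum => x _; rewrite ltn_ord mulr1 -real_normK ?num_real // expr_le1 //.
by case/andP: b01 => b0 b1; case: (X _); rewrite ler_norml /=; apply/andP; split; lra.
Qed.

(** Write the window counts as [V + b * I], from the balanced function and from the full cell. [V]
    has large energy by [fourier_wsum], [I] returns the old squared density, and the cross term
    would vanish without overhang, because [V] sums to zero. *)
Lemma nonuniform_window_energy (eta tau : R) n L X : (0 < n)%N -> (0 < L)%N ->
  (forall z, X z -> 0 <= z < n%:Z) -> tau <= 1 ->
  ((8 * L).+1 ^ 2 * L)%:R <= tau * n%:R -> ~ uniform eta n X ->
  exists q : nat, [/\ (0 < q)%N, (q <= (8 * L).+1 ^ 2)%N &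
   (L%:R * n%:R) ^+ 2 * ((cnt X n / n%:R) ^+ 2 + eta ^+ 2 / 4 - 4 * tau) <=
   (n + q * L)%:R * \sum_(k < n + q * L) cnt (subset_window q L k X) L ^+ 2].
Proof.
move=> n0 L0 hX tau1 hL nu.
have n0R : 0 < n%:R :> R by rewrite ltr0n.
have [w w1 hw] := nonuniform_fourier n0 hX nu.
set b := cnt X n / n%:R in hw *.
have b0 : 0 <= b by rewrite divr_ge0 ?cnt_ge0.
have b1 : b <= 1 by rewrite ler_pdivrMr // mul1r cnt_le.
pose J (z : int) : R := (0 <= z < n%:Z)%R%:R.
pose u := balanced n X.
have J0 : supported n J by move=> z; rewrite /J => /negbTE ->.
have u0 : supported n u.
  by move=> z hz; rewrite /u /balanced (supported_pred hX hz) -/(J z) J0 // mulr0 subr0.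
have [q [q0 qL hq]] := @fourier_wsum R u n L w _ u0 w1 L0 hw.
exists q; split => //; set m := (n + q * L)%N in hq *.
have mn : m%:R <= n%:R + tau * n%:R :> R.
  rewrite natrD lerD2l; apply: le_trans hL; rewrite ler_nat leq_mul2r.
  by rewrite qL orbT.
pose V k := wsum u q L k; pose I k := wsum J q L k.
have XE k : cnt (subset_window q L k X) L = V k + b * I k.
  rewrite cnt_window /V /I /wsum mulr_sumr -big_split /=; apply: eq_bigr => j _.
  by rewrite /u /balanced -/b -/(J _) subrK.
have sJ : \sum_(x < n) J x%:Z = n%:R.
  under eq_bigr do rewrite /J ltz_nat ltn_ord.
  by rewrite sumr_const card_ord.
have sI : \sum_(k < m) I k = L%:R * n%:R by rewrite (sum_wsum q L J0) sJ.
have sV : \sum_(k < m) V k = 0.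
  rewrite (sum_wsum q L u0) /u /balanced sumrB -mulr_sumr -/b sJ.
  by rewrite -[\sum_(_ < _) _]/(cnt X n) /b divfK ?subrr ?mulr0 // lt0r_neq0.
have I1 k : I k <= L%:R.
  apply: (@le_trans _ _ (\sum_(x < L) 1)); last by rewrite sumr_const card_ord.
  by apply: ler_sum => x _; rewrite /J; case: (_ && _).
have V1 k : V k <= L%:R.
  apply: (@le_trans _ _ (\sum_(x < L) 1)); last by rewrite sumr_const card_ord.
  apply: ler_sum => x _; rewrite /u /balanced -/b.
  by case: (X _); case: (_ && _); rewrite /= ?mulr1 ?mulr0; lra.
(* Compare [I k] with [L]: the shortfalls add up to [L * (m - n)], at most [L * tau * n], and [V k]
   is at most [L]. *)
have sVI : - (L%:R ^+ 2 * tau * n%:R) <= \sum_(k < m) V k * I k.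
  have -> : \sum_(k < m) V k * I k = \sum_(k < m) (V k * L%:R - V k * (L%:R - I k)).
    by apply: eq_bigr => k _; ring.
  rewrite sumrB -mulr_suml sV mul0r sub0r lerN2.
  apply: (@le_trans _ _ (\sum_(k < m) L%:R * (L%:R - I k))).
    by apply: ler_sum => k _; rewrite ler_wpM2r // subr_ge0.
  have sL : \sum_(k < m) L%:R = L%:R * m%:R :> R by rewrite sumr_const card_ord mulr_natr.
  rewrite -mulr_sumr sumrB sI sL -mulrBr mulrA -expr2 -mulrA.
  by apply: ler_wpM2l; rewrite ?sqr_ge0 // lerBlDl.
have sI2 : (L%:R * n%:R) ^+ 2 <= m%:R * \sum_(k < m) I k ^+ 2.
  by rewrite -sI; exact: (sqr_sum_ord m I).
have -> : \sum_(k < m) cnt (subset_window q L k X) L ^+ 2 =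
   \sum_(k < m) V k ^+ 2 + 2 * b * (\sum_(k < m) V k * I k) + b ^+ 2 * (\sum_(k < m) I k ^+ 2).
  rewrite !mulr_sumr -!big_split /=; apply: eq_bigr => k _.
  by rewrite XE; ring.
rewrite mulrDr mulrDr.
have h1 : (L%:R * n%:R) ^+ 2 * (eta ^+ 2 / 4) <= m%:R * \sum_(k < m) V k ^+ 2.
  by apply: le_trans hq; rewrite le_eqVlt; apply/orP; left; apply/eqP; field.
have h3 : (L%:R * n%:R) ^+ 2 * b ^+ 2 <= m%:R * (b ^+ 2 * \sum_(k < m) I k ^+ 2).
  by rewrite mulrC [X in _ <= X]mulrCA ler_wpM2l // sqr_ge0.
have h2 : - ((L%:R * n%:R) ^+ 2 * (4 * tau)) <= m%:R * (2 * b * (\sum_(k < m) V k * I k)).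
  have tn0 : 0 <= tau * n%:R by apply: le_trans hL.
  set W := \sum_(k < m) _ in sVI *.
  have m2 : m%:R <= 2 * n%:R :> R.
    apply: le_trans mn _; rewrite mulrDl mul1r lerD2l ler_piMl // ltW //.
  have P0 : 0 <= L%:R ^+ 2 * (tau * n%:R) :> R by rewrite mulr_ge0 ?sqr_ge0.
  have e1 : m%:R * (2 * b) * - (L%:R ^+ 2 * tau * n%:R) <= m%:R * (2 * b) * W.
    by rewrite ler_wpM2l // mulr_ge0 // mulr_ge0.
  have e2 : m%:R * b <= 2 * n%:R by apply: le_trans m2; rewrite ler_piMr.
  have := ler_wpM2r P0 e2.
  by nra.
by lra.
Qed.

End Cells.

(** * From integer cells to the cyclic group and back *)

Section Uniform.
Variable R : realType.
Implicit Types (X Y : pred int) (A : rel int).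
Local Notation cnt := (@cnt R).
Local Notation cnt2 := (@cnt2 R).

Definition pred_of_ord (m n : nat) (P : pred 'I_m.+1) : pred int :=
  fun z => if z is Posz k then (k < n)%N && P (inord k) else false.

Lemma sum_ord_pred (n : nat) (P : pred 'I_(2 * n).+1) :
  (forall g, P g -> (val g < n)%N) -> \sum_g (P g)%:R = cnt (pred_of_ord n P) n.
Proof.
move=> hP; rewrite /cnt /=.
rewrite -(@sum_ord_widen _ (fun k => ((k < n)%N && P (inord k))%:R) n (2 * n).+1).
- apply: eq_bigr => g _; rewrite inord_val.
  by case Pg: (P g); rewrite ?andbF // hP.
- by rewrite mul2n -addnn ltnW // ltnS leq_addr.
by move=> k kn; rewrite ltnNge kn.
Qed.

Lemma sum_ord_cnt (n : nat) X : (forall z, X z -> 0 <= z < n%:Z) ->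
  \sum_(g < (2 * n).+1) (X (val g)%:Z)%:R = cnt X n.
Proof.
move=> hX; apply: (@sum_ord_widen _ (fun k => (X k%:Z)%:R)).
  by rewrite mul2n -addnn ltnW // ltnS leq_addr.
move=> k kn; case Xk: (X _) => //.
by have := hX _ Xk; rewrite ltz_nat ltnNge kn andbF.
Qed.

(** The integer differences of the two legs lie strictly between [- n] and [n] and agree modulo
    [2 * n + 1]; so they are equal and the corner is one of integers. *)
Lemma ord_corner_free (n : nat) X Y A : cell n X Y A ->
  forall x y d : 'I_(2 * n).+1, A (val x)%:Z (val y)%:Z ->
  A (val (x + d))%:Z (val y)%:Z -> A (val x)%:Z (val (y + d))%:Z -> d = 0.
Proof.
move=> [hX hY hA hc] x y d a0 a1 a2.
have /andP[/hX x0 /hY y0] := hA _ _ a0.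
have /andP[/hX x1 _] := hA _ _ a1.
have /andP[_ /hY y1] := hA _ _ a2.
have xd : val (x + d) = ((x + d) %% (2 * n).+1)%N by [].
have yd : val (y + d) = ((y + d) %% (2 * n).+1)%N by [].
have dM := ltn_ord d.
have modE (a b : nat) : (a < n)%N -> (b < (2 * n).+1)%N ->
    ((a + b) %% (2 * n).+1 = a + b \/ (a + b) %% (2 * n).+1 + (2 * n).+1 = a + b)%N.
  move=> an bn; case: (ltnP (a + b) (2 * n).+1) => h; first by left; rewrite modn_small.
  by right; rewrite -{1}(subnK h) modnDr modn_small ?subnK //; lia.
have e : (val (y + d))%:Z = (val y)%:Z + ((val (x + d))%:Z - (val x)%:Z) :> int.
  have xn : (x < n)%N by case/andP: x0.
  have yn : (y < n)%N by case/andP: y0.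
  move: x1 y1; rewrite xd yd.
  by case: (modE x d xn dM); case: (modE y d yn dM) => /= ? ?; lia.
rewrite e in a2; have e2 : (val (x + d))%:Z = (val x)%:Z + ((val (x + d))%:Z - (val x)%:Z) :> int by ring.
rewrite e2 in a1; have /eqP := hc _ _ _ a0 a1 a2; rewrite subr_eq0 eqz_nat => /eqP/val_inj.
by move=> /(congr1 (fun t => t - x)); rewrite addrC addKr subrr.
Qed.

(** The length [n] of the cell is kept and only the sides shrink, so their densities in the cell
    have to be followed separately. *)
Lemma uniform_increment (n : nat) X Y A (al eta kappa : R) :
  (0 < n)%N -> cell n X Y A -> 0 < cnt X n -> 0 < cnt Y n ->
  al * (cnt X n * cnt Y n) = cnt2 A n -> 0 < al -> 0 < eta -> 0 < kappa <= 1 ->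
  2 ^+ 18 * kappa <= al ^+ 10 ->
  eta <= kappa * (cnt X n * cnt Y n / n%:R ^+ 2) ^+ 4 ->
  6 <= al ^+ 2 * (cnt X n * cnt Y n / n%:R ^+ 2) * n%:R ->
  uniform eta n X -> uniform eta n Y ->
  exists X' Y' A', [/\ cell n X' Y' A', cnt X' n * cnt Y' n <= cnt X n * cnt Y n &
    al * (cnt X' n * cnt Y' n) + kappa / 8 * (cnt X n * cnt Y n) <= cnt2 A' n].
Proof.
move=> n0 hcell cX0 cY0 alE al0 eta0 hk kal etak ngt uX uY.
have [hX hY hA hc] := hcell.
pose Ig (g : 'I_(2 * n).+1) := (val g < n)%N.
pose Xg (g : 'I_(2 * n).+1) := X (val g)%:Z.
pose Yg (g : 'I_(2 * n).+1) := Y (val g)%:Z.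
pose Ag (g h : 'I_(2 * n).+1) := A (val g)%:Z (val h)%:Z.
have n0R : 0 < n%:R :> R by rewrite ltr0n.
have XI g : Xg g -> Ig g by move=> /hX; rewrite ltz_nat.
have YI g : Yg g -> Ig g by move=> /hY; rewrite ltz_nat.
have sI : \sum_g (Ig g)%:R = n%:R :> R.
  rewrite /Ig (@sum_ord_widen _ (fun k => (k < n)%N%:R) n).
  - under eq_bigr do rewrite ltn_ord.
    by rewrite sumr_const card_ord.
  - by rewrite mul2n -addnn ltnW // ltnS leq_addr.
  by move=> k kn; rewrite ltnNge kn.
have sX : \sum_g (Xg g)%:R = cnt X n by exact: sum_ord_cnt.
have sY : \sum_g (Yg g)%:R = cnt Y n by exact: sum_ord_cnt.
have sA : \sum_g \sum_h (Ag g h)%:R = cnt2 A n.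
  rewrite /cnt2 -(@sum_ord_widen _ (fun k => \sum_(y < n) (A k%:Z y%:Z)%:R) n (2 * n).+1).
  - apply: eq_bigr => g _.
    by apply: (sum_ord_cnt (X := A (val g)%:Z)) => z /hA /andP[_ /hY].
  - by rewrite mul2n -addnn ltnW // ltnS leq_addr.
  move=> k kn; apply: big1 => y _; case Aky: (A _ _) => //.
  by case/andP: (hA _ _ Aky) => /hX; rewrite ltz_nat ltnNge kn andbF.
have := @density_increment R _ Ig Xg Yg Ag XI YI (fun g h => @hA _ _)
  (ord_corner_free hcell) al eta kappa.
rewrite sI sX sY sA card_ord.
case=> //.
- by rewrite -natrM ler_nat (ltn_pmul2r n0).
move=> X' [Y' [sX' sY' h]].
pose X1 := pred_of_ord n X'; pose Y1 := pred_of_ord n Y'.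
exists X1, Y1, (fun x y => [&& X1 x, Y1 y & A x y]).
have cX1 : cnt X1 n = \sum_g (X' g)%:R by rewrite sum_ord_pred // => g /sX'/XI.
have cY1 : cnt Y1 n = \sum_g (Y' g)%:R by rewrite sum_ord_pred // => g /sY'/YI.
split.
  split.
  - by case=> // k /andP[kn _]; rewrite ltz_nat.
  - by case=> // k /andP[kn _]; rewrite ltz_nat.
  - by move=> x y /and3P[-> ->].
  by move=> x y d /and3P[_ _ a0] /and3P[_ _ a1] /and3P[_ _ a2]; apply: hc a0 a1 a2.
  rewrite cX1 cY1 -sX -sY; apply: ler_pM; rewrite ?sumr_ge0 //; apply: ler_sum => g _.
    by case X'g: (X' g) => //; rewrite sX'.
  by case Y'g: (Y' g) => //; rewrite sY'.
rewrite cX1 cY1; apply: le_trans h _; rewrite le_eqVlt; apply/orP; left; apply/eqP.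
rewrite /cnt2 -(@sum_ord_widen _ (fun k => \sum_(y < n) ([&& X1 k%:Z, Y1 y%:Z & A k%:Z y%:Z])%:R) n (2 * n).+1).
- apply: eq_bigr => g _.
  rewrite -(@sum_ord_widen _ (fun y => ([&& X1 g%:Z, Y1 y%:Z & A g%:Z y%:Z])%:R) n (2 * n).+1).
  + apply: eq_bigr => h _; rewrite /X1 /Y1 /= !inord_val.
    case X'g: (X' g); rewrite ?andbF //=.
    have gn : (g < n)%N := XI _ (sX' _ X'g); rewrite gn /=.
    case Y'h: (Y' h); rewrite ?andbF //=.
    by have hn : (h < n)%N := YI _ (sY' _ Y'h); rewrite hn.
  + by rewrite mul2n -addnn ltnW // ltnS leq_addr.
  move=> k kn; have kn' : (k < n)%N = false by rewrite ltnNge kn.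
  by rewrite /Y1 /= kn' /= andbF.
- by rewrite mul2n -addnn ltnW // ltnS leq_addr.
move=> k kn; have kn' : (k < n)%N = false by rewrite ltnNge kn.
by apply: big1 => y _; rewrite /X1 /= kn'.
Qed.

End Uniform.

(** * The two nested iterations *)

Section Iteration.
Variable R : realType.
Implicit Types (X Y : pred int) (A : rel int).
Local Notation cnt := (@cnt R).
Local Notation cnt2 := (@cnt2 R).

(** Unlike the density of [A] in [X * Y], this is additive over pairs of windows, and windows with
    small sides carry little of it. *)
Definition excess (a : R) (n : nat) X Y A : R := cnt2 A n - a * (cnt X n * cnt Y n).

Lemma sum_excess_window (a : R) n q L X Y A : cell n X Y A ->
  \sum_(k < n + q * L) \sum_(l < n + q * L)
    excess a L (subset_window q L k X) (subset_window q L l Y) (subset_window2 q L k l A)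
  = L%:R ^+ 2 * excess a n X Y A.
Proof.
move=> hcell; have [hX hY _ _] := hcell.
under eq_bigr do rewrite sumrB -mulr_sumr -mulr_sumr.
rewrite sumrB (sum_cnt2_window R q L hcell) -mulr_sumr -mulr_suml.
by rewrite (sum_cnt_window R q L hX) (sum_cnt_window R q L hY) /excess; ring.
Qed.

Lemma nonuniform_cell_energy (eta tau : R) n L X Y A : (0 < n)%N -> (0 < L)%N ->
  cell n X Y A -> tau <= 1 -> ((8 * L).+1 ^ 2 * L)%:R <= tau * n%:R ->
  0 <= eta ^+ 2 / 4 - 4 * tau ->
  ~ (uniform eta n X /\ uniform eta n Y) ->
  exists q : nat, [/\ (0 < q)%N, (q <= (8 * L).+1 ^ 2)%N &
   (L%:R * n%:R) ^+ 2 * ((cnt X n / n%:R) ^+ 2 + (cnt Y n / n%:R) ^+ 2 + (eta ^+ 2 / 4 - 4 * tau)) <=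
   (n + q * L)%:R * (\sum_(k < n + q * L) cnt (subset_window q L k X) L ^+ 2
     + \sum_(k < n + q * L) cnt (subset_window q L k Y) L ^+ 2)].
Proof.
move=> n0 L0 [hX hY _ _] tau1 hL e0 /not_andP nu.
have n0R : n%:R != 0 :> R by rewrite pnatr_eq0 -lt0n.
have E Z : (L%:R * n%:R) ^+ 2 * (cnt Z n / n%:R) ^+ 2 = (L%:R * cnt Z n) ^+ 2 by field.
case: nu => nu.
  have [q [q0 qL h]] := nonuniform_window_energy n0 L0 hX tau1 hL nu.
  exists q; split=> //; have := window_energy_any R q L hY; rewrite -E => h2.
  by rewrite mulrDr; nra.
have [q [q0 qL h]] := nonuniform_window_energy n0 L0 hY tau1 hL nu.
exists q; split=> //; have := window_energy_any R q L hX; rewrite -E => h2.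
by rewrite mulrDr; nra.
Qed.

(* Each refinement of a non-uniform cell by windows costs a fixed amount of the
   energy deficit [2 - b1^2 - b2^2], so the excess density that survives [t]
   refinements without meeting a uniform cell is at most [O(1/t)]. *)
Lemma energy_induction (a eps eta tau : R) (h T : nat) :
  0 <= a -> 0 <= eps -> 0 < tau <= 1 -> 80 * tau <= eta ^+ 2 ->
  3 * tau * T%:R <= 1 -> 81 <= tau * h%:R ->
  (forall n X Y A, (h <= n)%N -> cell n X Y A -> uniform eta n X -> uniform eta n Y ->
    excess a n X Y A <= eps * n%:R ^+ 2) ->
  forall t, (t <= T)%N -> forall n X Y A, (h ^ (4 ^ t) <= n)%N -> cell n X Y A ->
  t%:R * (eta ^+ 2 / 16) * (excess a n X Y A / n%:R ^+ 2 - eps) <=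
  2 - (cnt X n / n%:R) ^+ 2 - (cnt Y n / n%:R) ^+ 2.
Proof.
move=> a0 eps0 /andP[tau0 tau1] taueta tauT tauh hunif.
have h0 : (0 < h)%N.
  rewrite lt0n; apply/eqP => h0; move: tauh; rewrite h0 mulr0.
  by rewrite (@ler_nat R 81 0).
have frac01 n Z : (0 < n)%N -> 0 <= cnt Z n / n%:R <= 1.
  by move=> n0; rewrite divr_ge0 ?cnt_ge0 //= ler_pdivrMr ?ltr0n // mul1r cnt_le.
have psi0 n X Y : (0 < n)%N -> 0 <= 2 - (cnt X n / n%:R) ^+ 2 - (cnt Y n / n%:R) ^+ 2.
  move=> n0; case/andP: (frac01 n X n0) => b0 b1; case/andP: (frac01 n Y n0) => c0 c1.
  have := exprn_ile1 2 b0 b1; have := exprn_ile1 2 c0 c1; lra.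
elim=> [|t IH] tT n X Y A hn hcell.
  rewrite !mul0r; apply: psi0; apply: leq_trans hn; by rewrite expn_gt0 h0.
have n0 : (0 < n)%N by apply: leq_trans hn; rewrite expn_gt0 h0.
have hhn : (h <= n)%N.
  by apply: leq_trans hn; rewrite -{1}[h]expn1 leq_pexp2l // expn_gt0.
have n0R : 0 < n%:R :> R by rewrite ltr0n.
have n2 : 0 < n%:R ^+ 2 :> R by rewrite exprn_gt0.
have c0 : 0 <= eta ^+ 2 / 16 by rewrite divr_ge0 ?sqr_ge0.
have [[uX uY]|nu] := pselect (uniform eta n X /\ uniform eta n Y).
  apply: le_trans (psi0 n X Y n0); rewrite mulr_ge0_le0 //; first by rewrite mulr_ge0.
  by rewrite subr_le0 ler_pdivrMr //; exact: hunif hhn hcell uX uY.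
(* The fourth root of the admissible length: [q] may reach [(9 * L) ^ 2], so the overhang [q * L] is
   at most [81 * L ^ 3], which is below [tau * L ^ 4]. *)
set L := (h ^ (4 ^ t))%N.
have L0 : (0 < L)%N by rewrite expn_gt0 h0.
have hL4 : (L ^ 4 <= n)%N by rewrite /L -expnM -expnSr.
have hhL : (h <= L)%N by rewrite -{1}[h]expn1 leq_pexp2l // expn_gt0.
have hLtau : ((8 * L).+1 ^ 2 * L)%:R <= tau * n%:R.
  apply: (@le_trans _ _ (81 * L%:R ^+ 3)).
    rewrite -natrX -natrM ler_nat; apply: (@leq_trans ((9 * L) ^ 2 * L)).
      by rewrite leq_mul2r leq_exp2r // [(9 * L)%N]mulSn addnC -addn1 leq_add2l L0 orbT.
    by rewrite expnMn -mulnA -expnSr.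
  apply: (@le_trans _ _ (tau * L%:R * L%:R ^+ 3)).
    apply: ler_wpM2r; first exact: exprn_ge0.
    by apply: le_trans tauh _; rewrite ler_pM2l // ler_nat.
  by rewrite -mulrA -exprS -natrX ler_pM2l // ler_nat.
have he : 0 <= eta ^+ 2 / 4 - 4 * tau by lra.
have [q [q0 qL hE]] := nonuniform_cell_energy n0 L0 hcell tau1 hLtau he nu.
set b1 := cnt X n / n%:R in hE *; set b2 := cnt Y n / n%:R in hE *.
set m := (n + q * L)%N in hE *.
have L0R : 0 < L%:R :> R by rewrite ltr0n.
have L2 : 0 < L%:R ^+ 2 :> R by rewrite exprn_gt0.
have mn : m%:R <= (1 + tau) * n%:R :> R.
  rewrite natrD mulrDl mul1r lerD2l; apply: le_trans hLtau.
  by rewrite ler_nat leq_mul2r qL orbT.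
have m2 : m%:R ^+ 2 <= (1 + 3 * tau) * n%:R ^+ 2 :> R.
  apply: (@le_trans _ _ (((1 + tau) * n%:R) ^+ 2)).
    by rewrite lerXn2r // nnegrE // mulr_ge0 // ?ler0n //; lra.
  rewrite exprMn ler_pM2r //.
  have : tau * tau <= tau by rewrite ler_piMr // ltW.
  by lra.
have sumIH : t%:R * (eta ^+ 2 / 16) * (L%:R ^+ 2 * excess a n X Y A - eps * L%:R ^+ 2 * m%:R ^+ 2)
  <= 2 * L%:R ^+ 2 * m%:R ^+ 2 - m%:R * (\sum_(k < m) cnt (subset_window q L k X) L ^+ 2
     + \sum_(k < m) cnt (subset_window q L k Y) L ^+ 2).
  have scon (x : R) : \sum_(k < m) x = m%:R * x by rewrite sumr_const card_ord mulr_natl.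
  have -> : t%:R * (eta ^+ 2 / 16) * (L%:R ^+ 2 * excess a n X Y A - eps * L%:R ^+ 2 * m%:R ^+ 2) =
    \sum_(k < m) \sum_(l < m) t%:R * (eta ^+ 2 / 16) *
     (excess a L (subset_window q L k X) (subset_window q L l Y) (subset_window2 q L k l A) - eps * L%:R ^+ 2).
    under eq_bigr do rewrite -mulr_sumr sumrB scon.
    by rewrite -mulr_sumr sumrB scon (sum_excess_window a q L hcell); ring.
  have -> : 2 * L%:R ^+ 2 * m%:R ^+ 2 - m%:R * (\sum_(k < m) cnt (subset_window q L k X) L ^+ 2
     + \sum_(k < m) cnt (subset_window q L k Y) L ^+ 2) =
     \sum_(k < m) \sum_(l < m) (2 * L%:R ^+ 2 - cnt (subset_window q L k X) L ^+ 2
       - cnt (subset_window q L l Y) L ^+ 2).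
    under [RHS]eq_bigr do rewrite sumrB scon.
    by rewrite [RHS]sumrB scon -mulr_sumr sumrB scon; ring.
  apply: ler_sum => k _; apply: ler_sum => l _.
  have := IH (ltnW tT) L _ _ _ (leqnn _) (cell_window L k l q0 hcell).
  move/(ler_wpM2r (ltW L2)).
  set P := excess _ _ _ _ _; set x := cnt (subset_window q L k X) L; set y := cnt (subset_window q L l Y) L.
  have -> : t%:R * (eta ^+ 2 / 16) * (P / L%:R ^+ 2 - eps) * L%:R ^+ 2 =
     t%:R * (eta ^+ 2 / 16) * (P - eps * L%:R ^+ 2) by field; exact: lt0r_neq0.
  have -> // : (2 - (x / L%:R) ^+ 2 - (y / L%:R) ^+ 2) * L%:R ^+ 2 = 2 * L%:R ^+ 2 - x ^+ 2 - y ^+ 2.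
  by field; exact: lt0r_neq0.
have h1 := le_trans sumIH (lerB (lexx _) hE).
set p := excess a n X Y A in h1 *.
set phi := p / n%:R ^+ 2.
have pE : p = phi * n%:R ^+ 2 by rewrite divfK // lt0r_neq0.
have phi1 : phi <= 1.
  rewrite ler_pdivrMr // mul1r /p /excess.
  have := cnt2_le_mul R hcell.
  have : cnt X n * cnt Y n <= n%:R ^+ 2 by rewrite expr2 ler_pM ?cnt_ge0 ?cnt_le.
  have : 0 <= a * (cnt X n * cnt Y n) by rewrite !mulr_ge0 ?cnt_ge0.
  lra.
have tc0 : 0 <= t%:R * (eta ^+ 2 / 16) by rewrite mulr_ge0.
have h2 : t%:R * (eta ^+ 2 / 16) * (phi - eps * (1 + 3 * tau)) <=
    2 * (1 + 3 * tau) - (b1 ^+ 2 + b2 ^+ 2 + (eta ^+ 2 / 4 - 4 * tau)).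
  rewrite -(ler_pM2r (mulr_gt0 L2 n2)).
  apply: (@le_trans _ _ (t%:R * (eta ^+ 2 / 16) * (L%:R ^+ 2 * p - eps * L%:R ^+ 2 * m%:R ^+ 2))).
    rewrite -[X in X <= _]mulrA; apply: ler_wpM2l => //; rewrite pE.
    have := ler_wpM2l (mulr_ge0 eps0 (ltW L2)) m2; lra.
  apply: le_trans h1 _.
  have := ler_wpM2l (ltW L2) m2; rewrite exprMn; lra.
(* There are about [(1 + 3 * tau) * n ^ 2] window pairs instead of [n ^ 2], which inflates [eps];
   [3 * tau * T <= 1] bounds the effect over all refinements. *)
have h3 : t%:R * (eta ^+ 2 / 16) * (eps * (3 * tau)) <= eta ^+ 2 / 16 * eps.
  have -> : t%:R * (eta ^+ 2 / 16) * (eps * (3 * tau)) = (3 * tau * t%:R) * (eta ^+ 2 / 16 * eps) by ring.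
  apply: ler_piMl; first exact: mulr_ge0.
  apply: le_trans tauT; apply: ler_wpM2l; last by rewrite ler_nat ltnW.
  by rewrite mulr_ge0 // ltW.
have h4 : eta ^+ 2 / 16 * phi <= eta ^+ 2 / 16 by rewrite ler_piMr.
(* The gain [eta ^ 2 / 4] pays for [10 * tau <= eta ^ 2 / 8] of overhang and for the [eta ^ 2 / 16]
   that the passage from [t] to [t + 1] costs. *)
rewrite -natr1; move: (t%:R) h2 h3 => s h2 h3; nra.
Qed.

(** Induction on the number [k] of increments left, after [j] of them. The induction hypothesis is a
    refutation: combined with [uniform_increment] it shows that no long uniform cell has excess
    above [eps], which is what [energy_induction] asks for; its conclusion then contradicts the
    excess of the present cell. With no increment left, [16 <= K * kappa] puts the density above
    1. *)
Lemma increment_iteration (d kappa th e eta tau : R) (K T h : nat) :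
  0 < d <= 1 -> 0 < kappa -> 2 ^+ 18 * kappa <= (d / 2) ^+ 10 -> 16 <= K%:R * kappa ->
  th = kappa ^+ 2 / 256 -> e = kappa / 32 * th ^+ K ->
  0 < eta -> eta <= kappa * e ^+ 4 -> 32 < T%:R * eta ^+ 2 * e ->
  0 < tau <= 1 -> 80 * tau <= eta ^+ 2 -> 3 * tau * T%:R <= 1 -> 81 <= tau * h%:R ->
  6 <= (d / 2) ^+ 2 * e * h%:R ->
  forall k j n X Y A, (k + j = K)%N -> (h ^ (4 ^ (T * k)) <= n)%N -> cell n X Y A ->
  th ^+ j * n%:R ^+ 2 <= cnt X n * cnt Y n ->
  (d + j%:R * (kappa / 16)) * (cnt X n * cnt Y n) <= cnt2 A n -> False.
Proof.
move=> /andP[d0 d1] k0 kd hK thE eE eta0 etae hT htau taueta tauT tauh hh.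
have dk : kappa <= d / 2.
  have h1 : (d / 2) ^+ 10 <= d / 2 by rewrite exprSr ler_piMl ?exprn_ile1 //; lra.
  have h2 : 1 <= 2 ^+ 18 :> R by rewrite exprn_ege1 //; lra.
  by apply: le_trans h1; apply: le_trans kd; rewrite ler_peMl // ltW.
have k1 : kappa <= 1 by lra.
have th0 : 0 < th by rewrite thE divr_gt0 ?exprn_gt0 ?ltr0n.
have th1 : th <= 1.
  rewrite thE ler_pdivrMr ?ltr0n // mul1r.
  by apply: le_trans (exprn_ile1 2 (ltW k0) k1) _; rewrite ler1n.
have e0 : 0 < e by rewrite eE mulr_gt0 ?exprn_gt0 // divr_gt0.
have h0 : (0 < h)%N.
  by case: (h) tauh => [|//]; rewrite mulr0 (@ler_nat R 81 0).
elim=> [|k IH] j n X Y A kj hn hcell hb hA.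
  have n0 : (0 < n)%N by apply: leq_trans hn; rewrite expn_gt0 h0.
  have P0 : 0 < cnt X n * cnt Y n.
    apply: lt_le_trans hb; rewrite mulr_gt0 ?exprn_gt0 ?ltr0n //.
  move: kj; rewrite add0n => jK; rewrite jK in hA.
  have := le_trans hA (cnt2_le_mul R hcell).
  rewrite -{2}[cnt X n * _]mul1r ler_pM2r // leNgt => /negP; apply.
  lra.
set h' := (h ^ (4 ^ (T * k)))%N.
have hh' : (h <= h')%N by rewrite -{1}[h]expn1 leq_pexp2l // expn_gt0.
have h'0 : (0 < h')%N by apply: leq_trans hh'.
have n0 : (0 < n)%N by apply: leq_trans hn; rewrite expn_gt0 h0.
have jK : (j <= K)%N by rewrite -kj leq_addl.
set b := th ^+ j.
have b0 : 0 < b by rewrite exprn_gt0.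
have bK : th ^+ K <= b by rewrite ler_wiXn2l // ltW.
(* Half of the excess [kappa / 16 * b] over [a1] known for the present cell; the other half drives
   [energy_induction]. *)
pose eps := kappa / 32 * b.
have eeps : e <= eps by rewrite eE ler_pM2l // divr_gt0.
have eps0 : 0 < eps by exact: lt_le_trans eeps.
(* A loss of [kappa / 16] is allowed on the way to a uniform cell; the increment [kappa / 8] there
   leaves a net gain of [kappa / 16]. *)
pose a1 := d + j%:R * (kappa / 16) - kappa / 16.
have jk0 : 0 <= j%:R * (kappa / 16) by rewrite mulr_ge0 // divr_ge0 // ltW.
have a1d : d / 2 <= a1 by rewrite /a1; lra.
have d20 : 0 < d / 2 by lra.
have hunif n' X' Y' A' : (h' <= n')%N -> cell n' X' Y' A' -> uniform eta n' X' ->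
    uniform eta n' Y' -> excess a1 n' X' Y' A' <= eps * n'%:R ^+ 2.
  move=> hn' hcell' uX uY; rewrite leNgt; apply/negP => hex.
  have n'0 : (0 < n')%N by exact: leq_trans hn'.
  have n2 : 0 < n'%:R ^+ 2 :> R by rewrite exprn_gt0 // ltr0n.
  have cP := cnt2_le_mul R hcell'.
  have hex' : a1 * (cnt X' n' * cnt Y' n') + eps * n'%:R ^+ 2 < cnt2 A' n'.
    by move: hex; rewrite /excess; lra.
  have P0 : 0 <= cnt X' n' * cnt Y' n' by rewrite mulr_ge0 ?cnt_ge0.
  have a1P : 0 <= a1 * (cnt X' n' * cnt Y' n') by rewrite mulr_ge0 //; lra.
  have Peps : eps * n'%:R ^+ 2 <= cnt X' n' * cnt Y' n' by lra.
  have Pp : 0 < cnt X' n' * cnt Y' n' by apply: lt_le_trans Peps; rewrite mulr_gt0.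
  have cX0 : 0 < cnt X' n'.
    by rewrite lt_def cnt_ge0 andbT; apply: contraTneq Pp => ->; rewrite mul0r ltxx.
  have cY0 : 0 < cnt Y' n'.
    by rewrite lt_def cnt_ge0 andbT; apply: contraTneq Pp => ->; rewrite mulr0 ltxx.
  pose al := cnt2 A' n' / (cnt X' n' * cnt Y' n').
  have alE : al * (cnt X' n' * cnt Y' n') = cnt2 A' n' by rewrite divfK // lt0r_neq0.
  have ala1 : a1 <= al.
    rewrite ler_pdivlMr //; apply: le_trans (ltW hex'); rewrite lerDl.
    by rewrite mulr_ge0 // ltW.
  have al0 : 0 < al by lra.
  have hk : 0 < kappa <= 1 by rewrite k0.
  have kal : 2 ^+ 18 * kappa <= al ^+ 10.
    apply: le_trans kd _.
    by rewrite lerXn2r ?nnegrE ?(ltW d20) ?(ltW al0) // (le_trans a1d ala1).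
  have eb : e <= cnt X' n' * cnt Y' n' / n'%:R ^+ 2.
    by rewrite ler_pdivlMr //; apply: le_trans Peps; rewrite ler_wpM2r // ltW.
  have etak : eta <= kappa * (cnt X' n' * cnt Y' n' / n'%:R ^+ 2) ^+ 4.
    apply: le_trans etae _; rewrite ler_pM2l // lerXn2r // ?nnegrE ?(ltW e0) //.
    exact: le_trans (ltW e0) eb.
  have ngt : 6 <= al ^+ 2 * (cnt X' n' * cnt Y' n' / n'%:R ^+ 2) * n'%:R.
    apply: le_trans hh _; apply: ler_pM => //.
    - by rewrite mulr_ge0 ?sqr_ge0 ?ltW.
    - apply: ler_pM; rewrite ?sqr_ge0 ?(ltW e0) //.
      by rewrite lerXn2r ?nnegrE ?(ltW d20) ?(ltW al0) // (le_trans a1d ala1).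
    - by rewrite ler_nat; apply: leq_trans hn'.
  have [X2 [Y2 [A2 [hcell2 P2 hA2]]]] :=
    uniform_increment n'0 hcell' cX0 cY0 alE al0 eta0 hk kal etak ngt uX uY.
  have Q0 : 0 <= cnt X2 n' * cnt Y2 n' by rewrite mulr_ge0 ?cnt_ge0.
  have k80 : 0 < kappa / 8 by rewrite divr_gt0.
  apply: (IH j.+1 n' X2 Y2 A2 _ hn' hcell2); first by rewrite -kj addSnnS.
    apply: le_trans (cnt2_le_mul R hcell2); apply: le_trans hA2.
    (* The increment itself bounds the new sides from below: [kappa / 8 * (kappa / 32)] is [th]. *)
    apply: (@le_trans _ _ (kappa / 8 * (eps * n'%:R ^+ 2))).
      by rewrite exprS /eps /b {1}thE le_eqVlt; apply/orP; left; apply/eqP; field.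
    have h1 : kappa / 8 * (eps * n'%:R ^+ 2) <= kappa / 8 * (cnt X' n' * cnt Y' n').
      by rewrite ler_pM2l.
    apply: le_trans h1 _; rewrite lerDr mulr_ge0 // ltW //.
  apply: le_trans hA2; rewrite -natr1.
  have h1 := ler_wpM2r Q0 ala1; have h2 := ler_wpM2l (ltW k80) P2.
  move: h1 h2; rewrite /a1; lra.
have := @energy_induction a1 eps eta tau h' T.
have tauh' : 81 <= tau * h'%:R.
  apply: le_trans tauh _; rewrite ler_wpM2l ?ler_nat //.
  by case/andP: htau => /ltW.
have a10 : 0 <= a1 by lra.
move=> /(_ a10 (ltW eps0) htau taueta tauT tauh' hunif T (leqnn T) n X Y A).
have hnT : (h' ^ (4 ^ T) <= n)%N.
  by rewrite /h' -expnM -expnD addnC -mulnS.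
move=> /(_ hnT hcell).
have n2 : 0 < n%:R ^+ 2 :> R by rewrite exprn_gt0 // ltr0n.
have hphi : e <= excess a1 n X Y A / n%:R ^+ 2 - eps.
  apply: le_trans eeps _; rewrite lerBrDr ler_pdivlMr // /excess /a1 /eps.
  have k160 : 0 < kappa / 16 by rewrite divr_gt0.
  have := ler_wpM2l (ltW k160) hb; rewrite -/b; lra.
have s1 : 0 <= (cnt X n / n%:R) ^+ 2 by rewrite sqr_ge0.
have s2 : 0 <= (cnt Y n / n%:R) ^+ 2 by rewrite sqr_ge0.
have Te : 0 <= T%:R * (eta ^+ 2 / 16) by rewrite mulr_ge0 // divr_ge0 ?sqr_ge0.
have := ler_wpM2l Te hphi.
set W := T%:R * _ * (_ - _); lra.
Qed.

End Iteration.

(** * Choice of constants *)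

Section Powers.
Variable R : realType.
Let r (k : nat) : R := 2 ^- k.

(** The required length is at most three exponentials of [t + s + 10]. This number is a linear
    function of [s] times [2 ^ (s + 4)], hence at most [2 ^ (2 * s + 4)], and
    [2 * s + 4 = 60 + 20 * p]. *)
Lemma tower_bound (p s E t : nat) : s = (28 + 10 * p)%N ->
  E = (s + 5 + (2 * s + 8) * 2 ^ (s + 4))%N -> t = (6 + 2 * (s + 4 * E) + E)%N ->
  ((2 ^ (t + 9)) ^ (4 ^ (2 ^ t * 2 ^ (s + 4))) <= 2 ^ (2 ^ (2 ^ (2 ^ (60 + 20 * p)))))%N.
Proof.
move=> sE EE tE.
rewrite -expnM leq_exp2l //.
have -> : (4 ^ (2 ^ t * 2 ^ (s + 4)) = 2 ^ (2 ^ (t + s + 5)))%N.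
  transitivity ((2 ^ 2) ^ (2 ^ t * 2 ^ (s + 4)))%N; first by [].
  by rewrite -expnM -expnD -expnS; congr (2 ^ (2 ^ _))%N; lia.
apply: (@leq_trans (2 ^ (t + 9) * 2 ^ (2 ^ (t + s + 5)))).
  by rewrite leq_mul2r ltnW ?orbT // ltn_expl.
rewrite -expnD leq_exp2l //.
apply: (@leq_trans (2 ^ (t + 9) + 2 ^ (t + s + 5))).
  by rewrite leq_add2r ltnW // ltn_expl.
apply: (@leq_trans (2 ^ (t + s + 10))).
  have -> : (t + s + 10 = (t + s + 9).+1)%N by lia.
  rewrite expnS mul2n -addnn; apply: leq_add; rewrite leq_exp2l //; lia.
rewrite leq_exp2l //.
have s28 : (28 <= s)%N by rewrite sE leq_addr.
(* Unfolded, [t + s + 10] is [12 * s + 61 + (18 * s + 72) * 2 ^ (s + 4)]; the coefficients add up to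
   30 and 133. *)
have h1 : (30 * s + 133 <= 2 ^ s)%N.
  elim: {E t sE EE tE} s s28 => // n IH; rewrite leq_eqVlt => /orP[/eqP <-|].
    by apply: (@leq_trans (2 ^ 10)); [lia|rewrite leq_exp2l].
  rewrite ltnS => /IH h; rewrite expnS; lia.
have -> : (60 + 20 * p = s + s + 4)%N by rewrite sE; lia.
have -> : (2 ^ (s + s + 4) = 2 ^ s * 2 ^ (s + 4))%N by rewrite -addnA expnD.
apply: leq_trans (leq_mul h1 (leqnn _)).
have : (0 < 2 ^ (s + 4))%N by rewrite expn_gt0.
by rewrite tE EE; move: (2 ^ (s + 4))%N => W; nia.
Qed.

Lemma cell_corner (p n : nat) (X Y : pred int) (A : rel int) :
  (2 ^ (2 ^ (2 ^ (2 ^ (60 + 20 * p)))) <= n)%N -> cell n X Y A ->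
  (forall x : nat, (x < n)%N -> X x%:Z) -> (forall y : nat, (y < n)%N -> Y y%:Z) ->
  r p * n%:R ^+ 2 <= cnt2 R A n -> False.
Proof.
move=> hn hcell fX fY hA.
have cntn (Z : pred int) : (forall x : nat, (x < n)%N -> Z x%:Z) -> cnt R Z n = n%:R.
  move=> fZ; rewrite /cnt; under eq_bigr do rewrite fZ ?ltn_ord //.
  by rewrite sumr_const card_ord.
have rD a b : r (a + b)%N = r a * r b by rewrite /r exprD invfM.
have rX a b : r a ^+ b = r (a * b)%N by rewrite /r exprVn exprM.
have rK k : (2 ^ k)%N%:R * r k = 1 :> R.
  by rewrite natrX divff // expf_neq0 // pnatr_eq0.
have r0 k : 0 < r k by rewrite invr_gt0 exprn_gt0.
have rN k : r k = (2 ^ k)%N%:R^-1 by rewrite natrX.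
have r1 k : r k <= 1 by rewrite rN invf_le1 ?ltr0n ?expn_gt0 // ler1n expn_gt0.
have bnd (E' : nat) :
  (3 + ((p + 1) * 2 + E') <= 6 + 2 * (28 + 10 * p + 4 * E') + E' + 9)%N by lia.
have t2 (E' F' : nat) : (6 + 2 * F' + E' + 2 = 7 + (1 + E') + 2 * F')%N by lia.
have t9 (t' : nat) : (t' + 9 = 7 + (t' + 2))%N by lia.
(* All parameters are powers of 2, so each constraint compares exponents:
   [2 ^ 18 * r s = (r p / 2) ^ 10], [K * r s = 16], [r F = r s * r E ^ 4], and
   [2 ^ t * r F ^ 2 * r E = 64]. *)
pose s := (28 + 10 * p)%N; pose K := (2 ^ (s + 4))%N.
pose E := (s + 5 + (2 * s + 8) * K)%N; pose F := (s + 4 * E)%N.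
pose t := (6 + 2 * F + E)%N.
have := @increment_iteration R (r p) (r s) (r (2 * s + 8)) (r E) (r F) (r (t + 2))
  K (2 ^ t)%N (2 ^ (t + 9))%N.
have c1 : 0 < r p <= 1 by rewrite r0 r1.
have rp2 : r p / 2 = r (p + 1) by rewrite rD /r expr1.
have c2 : 2 ^+ 18 * r s <= (r p / 2) ^+ 10.
  rewrite rp2 rX; have -> : (s = 18 + (p + 1) * 10)%N by rewrite /s; lia.
  by rewrite rD mulrA -natrX rK mul1r.
have c3 : 16 <= K%:R * r s.
  by rewrite /K addnC expnD natrM -mulrA rK mulr1 ler_nat.
have c4 : r (2 * s + 8) = r s ^+ 2 / 256 by rewrite rX rD mulnC; congr (_ * _); rewrite rN.
have c5 : r E = r s / 32 * r (2 * s + 8) ^+ K.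
  by rewrite rX /E [in LHS]rD [in LHS]rD; congr (_ * _ * _); rewrite rN.
have c6 : r F <= r s * r E ^+ 4 by rewrite rX -rD mulnC.
have c7 : 32 < (2 ^ t)%:R * r F ^+ 2 * r E.
  rewrite rX mulnC -mulrA -rD /t -addnA expnD natrM -mulrA rK mulr1 ltr_nat //.
have c8 : 0 < r (t + 2) <= 1 by rewrite r0 r1.
have c9 : 80 * r (t + 2) <= r F ^+ 2.
  rewrite rX mulnC; have -> : (t + 2 = 7 + (1 + E) + 2 * F)%N := t2 E F.
  rewrite rD mulrA ler_piMl ?(ltW (r0 _)) // rD mulrA.
  apply: mulr_ile1 => //; [by rewrite mulr_ge0 // ltW | by rewrite ltW |].
  by rewrite rN ler_pdivrMr ?mul1r ?ler_nat // ltr0n.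
have c10 : 3 * r (t + 2) * (2 ^ t)%:R <= 1.
  rewrite rD -mulrA mulrAC [r t * _]mulrC rK mul1r rN.
  by rewrite ler_pdivrMr ?ltr0n // mul1r ler_nat.
have c11 : 81 <= r (t + 2) * (2 ^ (t + 9))%:R.
  rewrite t9 expnD natrM mulrC -mulrA rK mulr1.
  by rewrite ler_nat.
have c12 : 6 <= (r p / 2) ^+ 2 * r E * (2 ^ (t + 9))%:R.
  rewrite rp2 rX -rD.
  have e := bnd E : (3 + ((p + 1) * 2 + E) <= t + 9)%N.
  rewrite -(subnK e) expnD natrM [(2 ^ (3 + _))%N]expnD natrM mulrC -!mulrA rK mulr1.
  apply: (@le_trans _ _ (1 * (2 ^ 3)%:R)); first by rewrite mul1r ler_nat.
  by apply: ler_wpM2r => //; rewrite ler1n expn_gt0.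
move=> /(_ c1 (r0 _) c2 c3 c4 c5 (r0 _) c6 c7 c8 c9 c10 c11 c12).
move=> /(_ K 0%N n X Y A (addn0 _)); apply => //.
- exact: leq_trans (@tower_bound p s E t erefl erefl erefl) hn.
- by rewrite expr0 mul1r !cntn // expr2.
by rewrite mul0r addr0 !cntn // -expr2.
Qed.

End Powers.

(** * The sign of the difference, and very dense sets *)

Section Reflection.
Variable R : realType.
Implicit Types (A : rel int).

Lemma sum_int_window (V : nmodType) (F : int -> V) (n m c : nat) : supported n F ->
  (c + n <= m)%N -> \sum_(k < m) F (k%:Z - c%:Z) = \sum_(x < n) F x%:Z.
Proof.
move=> F0 cm; rewrite (@sum_window _ (fun k => F (k%:Z - c%:Z)) n c) // => [|k hk].
  by apply: eq_bigr => x _; rewrite PoszD addrK.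
by apply: F0; apply: contra hk; lia.
Qed.

(* Intersecting with a reflected copy turns a corner with [d < 0] into one
   with [d > 0]. *)
Definition reflected (v w : nat) A : rel int :=
  fun x y => A x y && A (v%:Z - x) (w%:Z - y).

(** Average over the [(2 * n) ^ 2] values of [(v, w)]: each ordered pair of points of [A] is counted
    once, at its sum. *)
Lemma reflected_large (n : nat) A : (0 < n)%N ->
  (forall x y, A x y -> (0 <= x < n%:Z) && (0 <= y < n%:Z)) ->
  exists v w, cnt2 R A n ^+ 2 <= 4 * n%:R ^+ 2 * cnt2 R (reflected v w A) n.
Proof.
move=> n0 hA.
have n0R : 0 < n%:R :> R by rewrite ltr0n.
have E : \sum_(v < 2 * n) \sum_(w < 2 * n) cnt2 R (reflected v w A) n = cnt2 R A n ^+ 2.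
  transitivity (\sum_(x < n) \sum_(y < n) (A x%:Z y%:Z)%:R *
    (\sum_(v < 2 * n) \sum_(w < 2 * n) (A (v%:Z - x%:Z) (w%:Z - y%:Z))%:R) : R).
    under eq_bigr do rewrite /cnt2 exchange_big /=.
    rewrite exchange_big /=; apply: eq_bigr => x _.
    under eq_bigr do rewrite exchange_big /=.
    rewrite exchange_big /=; apply: eq_bigr => y _.
    rewrite mulr_sumr; apply: eq_bigr => v _; rewrite mulr_sumr; apply: eq_bigr => w _.
    by rewrite /reflected -natrM mulnb.
  rewrite expr2 {1}/cnt2 mulr_suml; apply: eq_bigr => x _.
  rewrite mulr_suml; apply: eq_bigr => y _; congr (_ * _).
  have F0 : supported n (fun z => \sum_(w < 2 * n) (A z (w%:Z - y%:Z))%:R : R).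
    move=> z hz; apply: big1 => w _; case Azw: (A _ _) => //.
    by case/andP: (hA _ _ Azw) => h; rewrite h in hz.
  rewrite (sum_int_window F0); last by rewrite mul2n -addnn leq_add2r ltnW.
  apply: eq_bigr => x' _.
  apply: (@sum_int_window _ (fun z => (A x'%:Z z)%:R : R) n (2 * n) y); last by rewrite mul2n -addnn leq_add2r ltnW.
  move=> z hz; case Azw: (A _ _) => //.
  by case/andP: (hA _ _ Azw) => _ h; rewrite h in hz.
apply: contrapT => H.
have : \sum_(v < 2 * n) \sum_(w < 2 * n) cnt2 R (reflected v w A) n
    < \sum_(v < 2 * n) \sum_(w < 2 * n) cnt2 R A n ^+ 2 / (4 * n%:R ^+ 2).
  have lt v w : cnt2 R (reflected v w A) n < cnt2 R A n ^+ 2 / (4 * n%:R ^+ 2).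
    rewrite ltr_pdivlMr ?mulr_gt0 ?exprn_gt0 // mulrC ltNge; apply/negP => h.
    by apply: H; exists v, w.
  have i0 : 'I_(2 * n) by apply: (@Ordinal _ 0); rewrite muln_gt0 n0.
  apply: ltr_sum => [|v _]; first by apply/hasP; exists i0; rewrite ?mem_index_enum.
  by apply: ltr_sum => [|w _ //]; apply/hasP; exists i0; rewrite ?mem_index_enum.
have scon (m : nat) (x : R) : \sum_(k < m) x = m%:R * x by rewrite sumr_const card_ord mulr_natl.
rewrite E !scon natrM.
have -> : 2 * n%:R * (2 * n%:R * (cnt2 R A n ^+ 2 / (4 * n%:R ^+ 2))) = cnt2 R A n ^+ 2.
  by field; exact: lt0r_neq0.
by rewrite ltxx.
Qed.

Lemma reflected_corner_free (v w : nat) A :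
  (forall x y d : int, 0 < d -> A x y -> A (x + d) y -> A x (y + d) -> False) ->
  corner_free (reflected v w A).
Proof.
move=> H x y d /andP[a0 b0] /andP[a1 b1] /andP[a2 b2].
case: (ltgtP d 0) => // hd; last by case: (H x y d).
have nd : 0 < - d by rewrite oppr_gt0.
case: (H (v%:Z - x) (w%:Z - y) (- d) nd b0).
  by rewrite (_ : v%:Z - x + - d = v%:Z - (x + d)) //; ring.
by rewrite (_ : w%:Z - y + - d = w%:Z - (y + d)) //; ring.
Qed.

(** Without a corner of difference 1, the indicator of [A] and its two unit shifts sum to at most 2
    everywhere. Shifting loses at most [n] points each time, and [9 / 4 * n ^ 2] exceeds
    [2 * n ^ 2 + 2 * n] when [n > 8]. *)
Lemma dense_unit_corner (n : nat) A : (8 < n)%N -> 3 / 4 * n%:R ^+ 2 <= cnt2 R A n ->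
  exists x y : int, [&& A x y, A (x + 1) y & A x (y + 1)].
Proof.
move=> n8 hA; apply: contrapT => H.
have n8R : 8 < n%:R :> R by rewrite ltr_nat.
have shift (F : nat -> R) : (forall k, 0 <= F k) -> \sum_(x < n) F x <= \sum_(x < n) F x.+1 + F 0%N.
  move=> F0; have : \sum_(i < n.+1) F i = \sum_(i < n.+1) F i by [].
  rewrite {1}big_ord_recr big_ord_recl /= => e.
  by rewrite addrC -[X in _ <= _ + X]/(\sum_(i < n) F (lift ord0 i)) -e lerDl.
have le1 (F : nat -> bool) : \sum_(x < n) (F x)%:R <= n%:R :> R.
  apply: (@le_trans _ _ (\sum_(x < n) 1)); last by rewrite sumr_const card_ord.
  by apply: ler_sum => x _; case: (F _).
have s1 : cnt2 R A n <= \sum_(x < n) \sum_(y < n) (A (x%:Z + 1) y%:Z)%:R + n%:R.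
  have := shift (fun x => \sum_(y < n) (A x%:Z y%:Z)%:R) (fun k => sumr_ge0 _ (fun _ _ => ler0n _ _)).
  move=> /le_trans; apply; apply: lerD; last exact: (le1 (fun y => A 0 y%:Z)).
  by apply: ler_sum => x _; apply: ler_sum => y _; rewrite -addn1 PoszD.
have s2 : cnt2 R A n <= \sum_(x < n) \sum_(y < n) (A x%:Z (y%:Z + 1))%:R + n%:R.
  apply: (@le_trans _ _ (\sum_(x < n) (\sum_(y < n) (A x%:Z (y%:Z + 1))%:R + (A x%:Z 0)%:R))).
    apply: ler_sum => x _; have := shift (fun y => (A x%:Z y%:Z)%:R) (fun k => ler0n _ _).
    move=> /le_trans; apply; apply: lerD => //.
    by apply: ler_sum => y _; rewrite -addn1 PoszD.
  by rewrite big_split /= lerD2l (le1 (fun x => A x%:Z 0)).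
have s3 : cnt2 R A n + \sum_(x < n) \sum_(y < n) (A (x%:Z + 1) y%:Z)%:R
   + \sum_(x < n) \sum_(y < n) (A x%:Z (y%:Z + 1))%:R <= 2 * n%:R ^+ 2.
  rewrite -!big_split /=.
  apply: (@le_trans _ _ (\sum_(x < n) \sum_(y < n) 2)); last first.
    have scon (m : nat) (x : R) : \sum_(k < m) x = m%:R * x by rewrite sumr_const card_ord mulr_natl.
    by rewrite !scon le_eqVlt; apply/orP; left; apply/eqP; ring.
  apply: ler_sum => x _; rewrite -!big_split /=; apply: ler_sum => y _.
  case a0: (A x%:Z y%:Z); case a1: (A (x%:Z + 1) y%:Z); case a2: (A x%:Z (y%:Z + 1)) => /=; try lra.
  by exfalso; apply: H; exists x%:Z, y%:Z; rewrite a0 a1 a2.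
nra.
Qed.

End Reflection.

Lemma pow2_le_expR (R : realType) (m : nat) (x : R) :
  m%:R <= x -> (2 ^ m)%N%:R <= expR x.
Proof.
move=> mx; apply: (@le_trans _ _ (expR m%:R)); last by rewrite ler_expR.
elim: {mx} m => [|m IH]; first by rewrite expR0.
rewrite expnS natrM mulrC -[m.+1%:R]natr1 expRD; apply: ler_pM => //.
by have := expR_ge1Dx (1 : R); lra.
Qed.

Lemma card_fset_le_cnt2 (R : realType) (N : nat) (A : {fset int * int}) :
  (forall p : int * int, p \in A -> (1 <= p.1 <= N%:Z) && (1 <= p.2 <= N%:Z)) ->
  (#|` A|%fset)%:R <= cnt2 R (fun x y : int => (x + 1, y + 1) \in A) N.
Proof.
move=> hA.
pose S := [pred p : 'I_N * 'I_N | ((val p.1)%:Z + 1, (val p.2)%:Z + 1) \in A].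
have -> : cnt2 R (fun x y : int => (x + 1, y + 1) \in A) N = #|S|%:R.
  rewrite /cnt2 pair_big /= -sum1_card natr_sum big_mkcond [RHS]big_mkcond /=.
  by apply: eq_bigr => p _; rewrite inE; case: (_ \in _).
rewrite ler_nat.
have -> : #|S| = size [seq ((val p.1)%:Z + 1, (val p.2)%:Z + 1) | p <- enum S].
  by rewrite size_map -cardE.
apply: uniq_leq_size; first exact: fset_uniq.
move=> [x y] pA; have /= /andP[/andP[x1 xN] /andP[y1 yN]] := hA _ pA.
have [a aE] : exists a : 'I_N, x = (val a)%:Z + 1.
  case: x x1 xN {pA} => // k k1 kN.
  by have kN' : (k.-1 < N)%N by [lia]; exists (Ordinal kN') => /=; lia.
have [b bE] : exists b : 'I_N, y = (val b)%:Z + 1.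
  case: y y1 yN {pA} => // k k1 kN.
  by have kN' : (k.-1 < N)%N by [lia]; exists (Ordinal kN') => /=; lia.
apply/mapP; exists (a, b); last by rewrite aE bE.
by rewrite mem_enum inE /= -aE -bE.
Qed.

Lemma exists_pow2_between (R : realType) (x : R) : 1 < x ->
  exists p : nat, x <= 2 ^+ p /\ 2 ^+ p <= 2 * x.
Proof.
move=> x1.
have ex : exists p : nat, x <= 2 ^+ p.
  exists (Num.truncn x).+1; apply: le_trans (ltW (truncnS_gt x)) _.
  by rewrite -natrX ler_nat ltnW // ltn_expl.
case: (ex_minnP ex) => p hp pmin; exists p; split => //.
case: p hp pmin => [|p] hp pmin; first by move: hp; rewrite expr0; lra.
rewrite exprS ler_pM2l // leNgt; apply/negP => /ltW /pmin.
by rewrite ltnn.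
Qed.

Theorem theorem1p4 (R : realType) :
  exists c : R, 0 < c /\
    forall (delta : R) (N : nat) (A : {fset int * int}),
      0 < delta <= 1 ->
      (0 < N)%N ->
      expR (expR (expR (powR delta (- c)))) <= N%:R ->
      (forall p : int * int, p \in A ->
         (1 <= p.1 <= N%:Z) && (1 <= p.2 <= N%:Z)) ->
      delta * N%:R ^+ 2 <= (#|` A|%fset)%:R ->
      exists k m d : int,
        0 < d /\ (k, m) \in A /\ (k + d, m) \in A /\ (k, m + d) \in A.
Proof.
(* [2 ^ (60 + 20 * p)] with [2 ^ p <= 8 * D ^ 2] is at most [2 ^ 120 * D ^ 40]; since [D >= 4 / 3]
   gives [2 <= D ^ 3], the exponent [3 * 120 + 40] suffices. *)
exists 400; split; first by rewrite ltr0n.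
move=> delta N A /andP[d0 d1] N0 hN hA hcard.
pose B : rel int := fun x y => (x + 1, y + 1) \in A.
have hB x y : B x y -> (0 <= x < N%:Z) && (0 <= y < N%:Z).
  by move=> /hA /=; lia.
have cB : delta * N%:R ^+ 2 <= cnt2 R B N := le_trans hcard (card_fset_le_cnt2 R hA).
have N2 : 0 < N%:R ^+ 2 :> R by rewrite exprn_gt0 // ltr0n.
pose D := delta^-1.
have D0 : 0 < D by rewrite invr_gt0.
have dD : delta * D = 1 by rewrite divff // lt0r_neq0.
have powE : powR delta (- 400) = D ^+ 400.
  by rewrite powRN powR_mulrn ?ltW // exprVn.
rewrite powE in hN.
have tower (m : nat) : m%:R <= D ^+ 400 -> (2 ^ (2 ^ (2 ^ m)) <= N)%N.
  move=> hm; rewrite -(@ler_nat R); apply: le_trans hN.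
  by do 3! apply: pow2_le_expR.
(* For [delta] near 1 no power of [D] absorbs the constant [2 ^ 120], so this range is settled
   directly. *)
have [dense|sparse] := leP (3 / 4) delta.
  have N8 : (8 < N)%N.
    apply: (@leq_trans (2 ^ (2 ^ (2 ^ 1)))) => //; apply: tower.
    by rewrite exprn_ege1 // -dD ler_piMl // ltW.
  have hB34 : 3 / 4 * N%:R ^+ 2 <= cnt2 R B N by apply: le_trans cB; rewrite ler_pM2r.
  have [x [y /and3P[b0 b1 b2]]] := dense_unit_corner N8 hB34.
  by exists (x + 1), (y + 1), 1.
apply: contrapT => nocorner.
have hBc x y d : 0 < d -> B x y -> B (x + d) y -> B x (y + d) -> False.
  move=> dp b0 b1 b2; apply: nocorner; exists (x + 1), (y + 1), d.
  by split=> //; split=> //; split; [move: b1|move: b2]; rewrite /B addrAC.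
have [v [w hvw]] := reflected_large R N0 hB.
have D43 : 4 / 3 <= D by rewrite -(ler_pM2l d0) dD; lra.
have D1 : 1 <= D by lra.
(* The reflected set has density at least [delta ^ 2 / 4], rounded down here to a power of
   [1 / 2]. *)
have [p [p1 p2]] : exists p : nat, 4 * D ^+ 2 <= 2 ^+ p /\ 2 ^+ p <= 2 * (4 * D ^+ 2).
  apply: exists_pow2_between; have := exprn_ege1 2 D1; lra.
pose I : pred int := fun z => 0 <= z < N%:Z.
have hcell : cell N I I (reflected v w B).
  split=> // [x y /andP[/hB]|] //; exact: reflected_corner_free hBc.
apply: (@cell_corner R p N I I _ _ hcell) => [|x xN|y yN|].
- apply: tower; rewrite natrX exprD [(20 * p)%N]mulnC exprM.
  apply: (@le_trans _ _ (2 ^+ 60 * (2 * (4 * D ^+ 2)) ^+ 20)).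
    have q0 : 0 <= 2 * (4 * D ^+ 2) by rewrite mulr_ge0 // mulr_ge0 // exprn_ge0 // ltW.
    by rewrite ler_pM2l ?exprn_gt0 // lerXn2r // nnegrE exprn_ge0.
  have -> : 2 ^+ 60 * (2 * (4 * D ^+ 2)) ^+ 20 = 2 ^+ 120 * D ^+ 40.
    have -> : 2 * (4 * D ^+ 2) = 2 ^+ 3 * D ^+ 2 by ring.
    by rewrite exprMn -!exprM mulrA -exprD.
  have -> : D ^+ 400 = (D ^+ 3) ^+ 120 * D ^+ 40 by rewrite -exprM -exprD.
  rewrite ler_pM2r ?exprn_gt0 // lerXn2r // ?nnegrE ?exprn_ge0 ?(ltW D0) //.
  apply: (@le_trans _ _ ((4 / 3) ^+ 3)); first by lra.
  by rewrite lerXn2r // nnegrE; lra.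
- by rewrite /I ltz_nat xN.
- by rewrite /I ltz_nat yN.
have N24 : 0 < 4 * N%:R ^+ 2 :> R by rewrite mulr_gt0.
rewrite -(ler_pM2l N24); apply: le_trans hvw.
apply: (@le_trans _ _ ((delta * N%:R ^+ 2) ^+ 2)); last first.
  have dN0 : 0 <= delta * N%:R ^+ 2 by rewrite mulr_ge0 // ltW.
  by rewrite lerXn2r // nnegrE // (le_trans dN0).
have -> : (delta * N%:R ^+ 2) ^+ 2 = delta ^+ 2 * N%:R ^+ 2 * N%:R ^+ 2 by ring.
have -> : 4 * N%:R ^+ 2 * (2 ^- p * N%:R ^+ 2) = 4 / 2 ^+ p * N%:R ^+ 2 * N%:R ^+ 2 :> R.
  by ring.
rewrite !ler_pM2r // ler_pdivrMr ?exprn_gt0 //.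
have := ler_wpM2l (ltW (exprn_gt0 2 d0)) p1.
have -> : delta ^+ 2 * (4 * D ^+ 2) = 4 * (delta * D) ^+ 2 by ring.
by rewrite dD expr1n mulr1.
Qed.
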